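(* Let $N>1$, let $\boldsymbol z=(z_1,\dots,z_N)$ be pairwise distinct complex numbers, and let $L(\lambda^{(i)})\cong V(\mu^{(i)})$, $1\le i\le N$, be irreducible polynomial $\mathfrak{gl}(m|n)$-modules for some hook partitions $\mu^{(1)},\dots,\mu^{(N)}$. Let $\boldsymbol l=(l_1,\dots,l_{m+n-1})$ be a tuple of non-negative integers with sum $l$ and $c:\{1,\dots,l\}\to\{1,\dots,m+n-1\}$ any function such that $c^{-1}(p)$ has $l_p$ elements for all $p$. If $\boldsymbol t=(t_1,\dots,t_l)\in\mathbb C^l$ satisfies the Bethe equations $$-\sum_{s=1}^N\frac{(\alpha_{c(i)},\lambda^{(s)})}{t_i-z_s}+\sum_{\substack{j=1\\ j\ne i}}^l\frac{(\alpha_{c(i)},\alpha_{c(j)})}{t_i-t_j}=0,\qquad i=1,\dots,l,$$ then the weight function $w(\boldsymbol z,\boldsymbol t)\in L(\lambda^{(1)})\otimes\cdots\otimes L(\lambda^{(N)})$ is an eigenvector of the Gaudin Hamiltonian $$\mathcal H_i=\sum_{\substack{j=1\\ j\neq i}}^N\frac{\sum_{a,b}E^{(i)}_{ab}E^{(j)}_{ba}(-1)^{|b|}}{z_i-z_j}$$ with eigenvalue $$\mathcal E_i=\sum_{\substack{j=1\\ j\ne i}}^N\frac{(\lambda^{(i)},\lambda^{(j)})}{z_i-z_j}+\sum_{j=1}^{l}\frac{(\lambda^{(i)},\alpha_{c(j)})}{t_j-z_i},$$ for each $1\le i\le N$.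
   Context: Lie superalgebra. $\mathbb C^{m|n}$ is the complex superspace with homogeneous basis $e_1,\dots,e_{m+n}$, $m$ of which are even and $n$ odd, in any fixed order subject to $e_1$ being even; $|a|\in\{0,1\}$ is the parity of $e_a$. $\mathfrak{gl}(m|n)$ has basis $E_{ab}$ ($1\le a,b\le m+n$) of parity $|a|+|b|$, with $[E_{ab},E_{cd}]=\delta_{bc}E_{ad}-(-1)^{(|a|+|b|)(|c|+|d|)}\delta_{ad}E_{cb}$; it acts on its defining representation $\mathbb C^{m|n}$ by $E_{ab}e_c=\delta_{bc}e_a$. $\mathfrak h$ is spanned by the $E_{aa}$, $\mathfrak n^+$ by the $E_{ab}$ with $a<b$. Let $\epsilon_a\in\mathfrak h^*$ be the basis dual to $E_{aa}$, with bilinear form $(\epsilon_a,\epsilon_b)=(-1)^{|a|}\delta_{ab}$; the simple roots are $\alpha_a=\epsilon_a-\epsilon_{a+1}$, and $F_a=E_{a+1,a}$ has parity $|F_a|$ equal to $|a|+|a+1|$ mod 2, $1\le a\le m+n-1$. $L(\lambda)$ is the irreducible highest weight module of highest weight $\lambda$ (with respect to $\mathfrak h\oplus\mathfrak n^+$), with a fixed highest weight vector $v_\lambda$, which is homogeneous for the $\mathbb Z_2$-grading but whose parity is left unspecified. Tensor products follow the super sign rule $(a\otimes b)(v\otimes w)=(-1)^{|b||v|}av\otimes bw$; $E^{(k)}_{ab}$ denotes $1\otimes\cdots\otimes E_{ab}\otimes\cdots\otimes1$ with $E_{ab}$ in the $k$-th tensor factor. Polynomial modules. The irreducible polynomial modules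 are the irreducible modules occurring as submodules of tensor powers $(\mathbb C^{m|n})^{\otimes k}$, $k\ge0$. They are in one-to-one correspondence with hook partitions $\mu$ (partitions with $\mu_{m+1}\le n$). The module attached to $\mu$ is $V(\mu)\cong L(\lambda)$ with $\lambda=\sum_a\lambda_a\epsilon_a$ read off from the Young diagram of $\mu$: for $a=1,2,\dots,m+n$ in turn, remove the first remaining row if $|a|=0$, or the first remaining column if $|a|=1$; $\lambda_a$ is the number of boxes removed at step $a$. Weight function. Let $P_{l,N}$ be the set of ordered partitions: tuples $\boldsymbol n=(n^1_1,\dots,n^1_{p_1};\dots;n^N_1,\dots,n^N_{p_N})$ with $p_k\ge0$, $p_1+\dots+p_N=l$, whose concatenation is a permutation of $(1,\dots,l)$. Put $$F_{\boldsymbol n}v=F_{c(n^1_1)}\cdots F_{c(n^1_{p_1})}v_{\lambda^{(1)}}\otimes\cdots\otimes F_{c(n^N_1)}\cdots F_{c(n^N_{p_N})}v_{\lambda^{(N)}},$$ $$\omega_{\boldsymbol n}(\boldsymbol z,\boldsymbol t)=\prod_{k=1}^N\frac1{(t_{n^k_1}-t_{n^k_2})\cdots(t_{n^k_{p_k-1}}-t_{n^k_{p_k}})(t_{n^k_{p_k}}-z_k)}$$ (the $k$-th factor is $1$ if $p_k=0$), and let $(-1)^{|\boldsymbol n|}$ be $-1$ to the power of the number of pairs $i<j$ with $|F_{c(i)}|=|F_{c(j)}|=1$ such that $j$ appears before $i$ in the concatenated list. The weight function is $w(\boldsymbol z,\boldsymbol t)=\sum_{\boldsymbol n\in P_{l,N}}(-1)^{|\boldsymbol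 n|}\omega_{\boldsymbol n}(\boldsymbol z,\boldsymbol t)F_{\boldsymbol n}v$.
   Formalization: ''Eigenvector'' means H_i w = E_i w, without w ≠ 0 (w can vanish, e.g. for gl(2), N = l = 2); for odd highest weight vectors F_n v carries the super sign from moving the F's past them, as the plain tensor product fails for gl(1|1). *)

(* Defs.v *)
From HB Require Import structures.
From mathcomp Require Import all_boot all_order all_algebra.
From mathcomp Require Import reals complex.

Set Implicit Arguments.
Unset Strict Implicit.
Unset Printing Implicit Defensive.

Import GRing.Theory.
Local Open Scope ring_scope.

(* Throughout, the r.+1 = m + n basis vectors of C^{m|n} are indexed by
   'I_r.+1, with [par a] = true iff e_a is odd; the simple roots are indexed
   by 'I_r.  All indices start at 0. *)

Section Weights.
Variables (C : fieldType) (r : nat) (par : 'I_r.+1 -> bool).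

(* h^* is 'rV[C]_r.+1, with eps a the basis dual to the E_aa. *)
Definition eps (a : 'I_r.+1) : 'rV[C]_r.+1 := delta_mx 0 a.

Definition wform (x y : 'rV[C]_r.+1) : C :=
  \sum_a (-1) ^+ par a * x 0 a * y 0 a.

Definition lo (a : 'I_r) : 'I_r.+1 := widen_ord (leqnSn r) a.
Definition hi (a : 'I_r) : 'I_r.+1 := lift ord0 a.

Definition simple_root (a : 'I_r) : 'rV[C]_r.+1 := eps (lo a) - eps (hi a).

Definition Fpar (a : 'I_r) : bool := par (lo a) (+) par (hi a).

(* A partition is the weakly decreasing list of its positive parts, so that
   [size mu] is the length of its first column. *)
Definition is_hook_partition (m n : nat) (mu : seq nat) : bool :=
  [&& sorted geq mu, 0%N \notin mu & (nth 0%N mu m <= n)%N].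

(* [true] removes the first column, [false] the first row. *)
Fixpoint peel (ps : seq bool) (mu : seq nat) : seq nat :=
  match ps with
  | [::] => [::]
  | true :: ps' => size mu :: peel ps' [seq x.-1 | x <- mu & (1 < x)%N]
  | false :: ps' => head 0%N mu :: peel ps' (behead mu)
  end.

Definition hook_weight (mu : seq nat) : 'rV[C]_r.+1 :=
  \row_a (nth 0%N (peel [seq par b | b <- enum 'I_r.+1] mu) a)%:R.

End Weights.

(* A finite-dimensional gl(m|n)-module, on column vectors, in a basis of
   homogeneous vectors; [mpar] is the parity of the basis vectors. *)
Record glmod (C : fieldType) (r : nat) (par : 'I_r.+1 -> bool) := GlMod {
  mdim : nat;
  mpar : 'I_mdim -> bool;
  act : 'I_r.+1 -> 'I_r.+1 -> 'M[C]_mdim;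
  act_homog : forall a b i j,
    act a b i j != 0 -> mpar i = par a (+) par b (+) mpar j;
  act_bracket : forall a b c d,
    let s : C := (-1) ^+ ((par a (+) par b) && (par c (+) par d)) in
    act a b *m act c d - s *: (act c d *m act a b) =
      (b == c)%:R *: act a d - s *: ((a == d)%:R *: act c b)
}.

Section Modules.
Variables (C : fieldType) (r : nat) (par : 'I_r.+1 -> bool).
Implicit Type M : glmod C par.

Lemma defmod_homog (a b i j : 'I_r.+1) :
  (delta_mx a b : 'M[C]_r.+1) i j != 0 -> par i = par a (+) par b (+) par j.
Proof.
rewrite mxE; have [-> | _] := eqVneq i a; have [-> | _] := eqVneq j b;
  rewrite ?eqxx //= => _.
by rewrite -addbA addbb addbF.
Qed.

Lemma defmod_bracket (a b c d : 'I_r.+1) :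
  let s : C := (-1) ^+ ((par a (+) par b) && (par c (+) par d)) in
  (delta_mx a b : 'M[C]_r.+1) *m delta_mx c d
    - s *: (delta_mx c d *m delta_mx a b) =
  (b == c)%:R *: delta_mx a d - s *: ((a == d)%:R *: delta_mx c b).
Proof.
move=> s; rewrite !mul_delta_mx_cond [d == a]eq_sym.
by rewrite !scaler_nat.
Qed.

(* The defining representation C^{m|n}: E_ab e_c = delta_bc e_a. *)
Definition defmod : glmod C par :=
  @GlMod C r par r.+1 par (@delta_mx C r.+1 r.+1) defmod_homog defmod_bracket.

Definition homogeneous M (p : bool) (v : 'cV[C]_(mdim M)) : Prop :=
  forall i, v i 0 != 0 -> mpar i = p.

Definition component M (p : bool) (v : 'cV[C]_(mdim M)) : 'cV[C]_(mdim M) :=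
  \col_i (if mpar i == p then v i 0 else 0).

Definition is_submodule M (U : {vspace 'cV[C]_(mdim M)}) : Prop :=
  (forall p v, v \in U -> component p v \in U) /\
  (forall a b v, v \in U -> act M a b *m v \in U).

Definition irreducible M : Prop :=
  (0 < mdim M)%N /\
  forall U : {vspace 'cV[C]_(mdim M)},
    is_submodule U -> U = 0%VS \/ U = fullv.

Definition highest_weight_vector M (lam : 'rV[C]_r.+1) (v : 'cV[C]_(mdim M))
    : Prop :=
  [/\ v != 0,
      forall a b : 'I_r.+1, (a < b)%N -> act M a b *m v = 0
    & forall a, act M a a *m v = lam 0 a *: v].

(* M_0 (x) ... (x) M_{N-1}, through the coordinates in the basis of the
   e_{x_0} (x) ... (x) e_{x_{N-1}}. *)
Definition tens (N : nat) (M : 'I_N -> glmod C par) : Type :=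
  {ffun {dffun forall k : 'I_N, 'I_(mdim (M k))} -> C^o}.

Section Tensor.
Variables (N : nat) (M : 'I_N -> glmod C par).
Local Notation tindex := {dffun forall k : 'I_N, 'I_(mdim (M k))}.

Definition pure (v : forall k, 'cV[C]_(mdim (M k))) : tens M :=
  [ffun x : tindex => \prod_k v k (x k) 0].

(* E_ab^(k); the sign comes from moving E_ab past the first k factors. *)
Definition Esite (k : 'I_N) (a b : 'I_r.+1) (f : tens M) : tens M :=
  [ffun y : tindex =>
    \sum_(x : tindex | [forall j, (j != k) ==> (x j == y j)])
       (-1) ^+ ((par a (+) par b) *
                \sum_(j < N | (j < k)%N) mpar (x j))%N
       * act (M k) a b (y k) (x k) * f x].

Definition Etot (a b : 'I_r.+1) (f : tens M) : tens M :=
  \sum_k Esite k a b f.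

Definition gaudin (z : 'I_N -> C) (i : 'I_N) (f : tens M) : tens M :=
  \sum_(j < N | j != i)
    (z i - z j)^-1 *:
      \sum_a \sum_b (-1) ^+ par b *: Esite i a b (Esite j b a f).

End Tensor.

(* M occurs as a submodule of (C^{m|n})^{(x) k} for some k: there is an
   injective intertwiner, homogeneous of some degree p, so that the
   highest weight vector of M may have either parity. *)
Definition polynomial_module M : Prop :=
  exists (k : nat) (p : bool)
         (f : {linear 'cV[C]_(mdim M) -> tens (fun _ : 'I_k => defmod)}),
    [/\ injective f,
        forall (i : 'I_(mdim M)) x, f (delta_mx i 0) x != 0 ->
          odd (\sum_(s < k) par (x s))%N = mpar i (+) p
      & forall a b v, f (act M a b *m v) = Etot a b (f v)].

Section WeightFunction.
Variables (N l : nat) (c : 'I_l -> 'I_r).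
Variables (z : 'I_N -> C) (t : 'I_l -> C).

(* The k-th sequence has at most l entries, so nothing is lost by bounding
   its length. *)
Definition ordered_partitions : {set {ffun 'I_N -> l.-bseq 'I_l}} :=
  [set n : {ffun 'I_N -> l.-bseq 'I_l} |
     perm_eq (flatten [seq val (n k) | k <- enum 'I_N]) (enum 'I_l)].

Definition sgn_exp (n : {ffun 'I_N -> l.-bseq 'I_l}) : nat :=
  let s := flatten [seq val (n k) | k <- enum 'I_N] in
  #|[set ij : 'I_l * 'I_l |
      [&& (ij.1 < ij.2)%N, Fpar par (c ij.1), Fpar par (c ij.2)
        & (index ij.2 s < index ij.1 s)%N]]|.

Fixpoint omega1 (zk : C) (s : seq 'I_l) : C :=
  if s is i :: s' then (t i - head zk [seq t j | j <- s'])^-1 * omega1 zk s'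
  else 1.

Definition omega (n : {ffun 'I_N -> l.-bseq 'I_l}) : C :=
  \prod_k omega1 (z k) (n k).

Definition Fmonomial M (s : seq 'I_l) (v : 'cV[C]_(mdim M)) : 'cV[C]_(mdim M) :=
  foldr (fun i u => act M (hi (c i)) (lo (c i)) *m u) v s.

Variables (M : 'I_N -> glmod C par) (v : forall k, 'cV[C]_(mdim (M k))).
Variable q : 'I_N -> bool. (* q k is the parity of v k *)

(* F_n v is (F...F) (x) ... (x) (F...F) applied to v_0 (x) ... (x) v_{N-1} by
   the super sign rule.  This is the plain tensor product of the F...F v_k when
   the v_k are even (Fvec_even below).  For odd v_k the sign matters: without
   it the weight function need not be an eigenvector. *)
Definition Fvec (n : {ffun 'I_N -> l.-bseq 'I_l}) : tens M :=
  (-1) ^+ (\sum_(k < N) \sum_(j < N | (j < k)%N)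
             q j * count (fun i => Fpar par (c i)) (n k))%N
  *: pure (fun k => Fmonomial (n k) (v k)).

Lemma Fvec_even n : (forall k, q k = false) ->
  Fvec n = pure (fun k => Fmonomial (n k) (v k)).
Proof.
move=> q0; rewrite /Fvec big1 ?expr0 ?scale1r // => k _.
by rewrite big1 // => j _; rewrite q0.
Qed.

Definition weight_function : tens M :=
  \sum_(n in ordered_partitions) ((-1) ^+ sgn_exp n * omega n) *: Fvec n.

(* The first two clauses say that no denominator vanishes. *)
Definition bethe_equations (lam : 'I_N -> 'rV[C]_r.+1) : Prop :=
  [/\ forall i s, t i != z s,
      injective t
    & forall i,
        - \sum_s wform par (simple_root C (c i)) (lam s) / (t i - z s)
        + \sum_(j < l | j != i)
            wform par (simple_root C (c i)) (simple_root C (c j)) / (t i - t j)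
        = 0].

Definition gaudin_eigenvalue (lam : 'I_N -> 'rV[C]_r.+1) (i : 'I_N) : C :=
  \sum_(j < N | j != i) wform par (lam i) (lam j) / (z i - z j)
  + \sum_(j < l) wform par (lam i) (simple_root C (c j)) / (t j - z i).

End WeightFunction.
End Modules.

(* Main.v *)
From HB Require Import structures.
Require Import Defs.
From mathcomp Require Import all_boot all_order all_algebra.
From mathcomp Require Import reals complex.
From mathcomp Require Import ring.

(* The identity is proved for arbitrary highest weight modules, one pair of
   sites (i, j) at a time and before imposing the Bethe equations.

   Tensoring with a Grassmann algebra that has one generator per letter turns
   the operators F into even ones, f_m at site i and f'_m at site j, which
   commute with each other.  Writing Omega_ij = Omega_0 + H_ij + H_ji with
   H_ij = sum_(a > b) (-1)^|b| E_ab^(i) E_ba^(j), the invariance of the Casimir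
   tensor gives [H_ij, f_m + f'_m] = f_m h'_m, where h'_m is a coroot acting at
   site j; no nonsimple root is left.  Let Q(I, J) be
     sum_(m in I) (t_m - z_i) ((alpha_m, lambda_j) / (t_m - z_j)
        + sum_(r in J) (alpha_m, alpha_r) / (t_r - t_m)).
   Then H_ij multiplies the summand of the weight function with words I, J at
   sites i, j by Q(I, J), in the sense that the sums over all (I, J) agree.
   This goes by induction on the number of letters, peeling off the first
   letter of I or J, with parameter x or y, with the help of
     (u - z_i) / ((u - x) (u - y)) =
       (x - z_i) / ((u - x) (x - y)) + (y - z_i) / ((u - y) (y - x)).

   Adding up, the Hamiltonian multiplies the summand of an ordered partition n
   by the announced eigenvalue plus the Bethe equations of all letters
   at site i. *)

Set Implicit Arguments.
Unset Strict Implicit.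
Unset Printing Implicit Defensive.

Import GRing.Theory.
Local Open Scope ring_scope.

(** * Words *)

Section Words.
Variable L : finType.
Local Notation wpair := (seq L * seq L)%type.

Fixpoint words (d : nat) : seq (seq L) :=
  if d is d'.+1 then [seq m :: s | m <- enum L, s <- words d'] else [:: [::]].

Fixpoint word_pairs (d : nat) : seq wpair :=
  if d is d'.+1 then
    [seq (m :: x.1, x.2) | m <- enum L, x <- word_pairs d'] ++
    [seq ([::], s) | s <- words d]
  else [:: ([::], [::])].

Lemma mem_words d s : (s \in words d) = (size s == d).
Proof.
elim: d s => [|d IH] [|m s] //=.
  by apply/allpairsP=> -[[a b] []].
rewrite eqSS -IH; apply/allpairsP/idP => [[[a b] /= [_ bd [_ ->]]]|sd] //.
by exists (m, s); rewrite mem_enum.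
Qed.

Lemma words_uniq d : uniq (words d).
Proof.
elim: d => //= d IH; apply: allpairs_uniq => //; first exact: enum_uniq.
by move=> [a b] [a' b'] _ _ /= [-> ->].
Qed.

Lemma mem_word_pairs d (x : wpair) :
  (x \in word_pairs d) = (size x.1 + size x.2 == d)%N.
Proof.
elim: d x => [|d IH] [[|m I] J].
- by rewrite inE xpair_eqE /= add0n size_eq0.
- by rewrite inE xpair_eqE.
- rewrite mem_cat; have -> : ([::], J) \in [seq (m :: x.1, x.2)
      | m <- enum L, x <- word_pairs d] = false.
    by apply/allpairsP=> -[[a b] []].
  rewrite mem_map; last by move=> ? ? [].
  by rewrite mem_words add0n.
- rewrite mem_cat orbC; have -> : (m :: I, J) \in [seq ([::], s)
      | s <- words d.+1] = false by apply/mapP=> -[].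
  rewrite addSn eqSS -[RHS](IH (I, J)).
  apply/allpairsP/idP => [[[a [b1 b2]] /= [_ bd [_ -> ->]]]|sd] //.
  by exists (m, (I, J)); rewrite mem_enum.
Qed.

Lemma word_pairs_uniq d : uniq (word_pairs d).
Proof.
elim: d => // d IH; rewrite [word_pairs _]/= cat_uniq; apply/and3P; split.
- apply: allpairs_uniq => //; first exact: enum_uniq.
  by move=> [a [b c]] [a' [b' c']] _ _ /= [-> -> ->].
- by apply/hasPn=> _ /mapP[s _ ->]; apply/allpairsP=> -[[a b] []].
- by rewrite map_inj_uniq ?(words_uniq d.+1) // => ? ? [].
Qed.

(** The recursion of [word_pairs] favours the first word. Letters are peeled off either word, so the
    enumeration led by the second word is required too. *)
Lemma word_pairs_perm d :
  perm_eq (word_pairs d.+1)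
    ([seq (x.1, m :: x.2) | m <- enum L, x <- word_pairs d] ++
     [seq (s, [::]) | s <- words d.+1]).
Proof.
apply: uniq_perm; first exact: word_pairs_uniq.
  rewrite cat_uniq; apply/and3P; split.
  - apply: allpairs_uniq; [exact: enum_uniq|exact: word_pairs_uniq|].
    by move=> [a [b c]] [a' [b' c']] _ _ /= [-> -> ->].
  - by apply/hasPn=> _ /mapP[s _ ->]; apply/allpairsP=> -[[a b] []].
  - by rewrite map_inj_uniq ?words_uniq // => ? ? [].
move=> [I [|m J]]; rewrite mem_word_pairs mem_cat.
  have -> : (I, [::]) \in [seq (x.1, m :: x.2)
      | m <- enum L, x <- word_pairs d] = false.
    by apply/allpairsP=> -[[a b] []].
  by rewrite mem_map ?mem_words ?addn0 // => ? ? [].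
rewrite orbC; have -> : (I, m :: J) \in [seq (s, [::])
    | s <- words d.+1] = false by apply/mapP=> -[].
rewrite addnS eqSS -[LHS](mem_word_pairs d (I, J)).
apply/idP/allpairsP => [sd|[[a [b1 b2]] /= [_ bd [-> _ ->]]]] //.
by exists (m, (I, J)); rewrite mem_enum.
Qed.

(** Not all of [A] has to occur. Only together with total length [#|A|] does this say that each
    letter of [A] is used exactly once. *)
Definition spells_in (A : {set L}) (x : wpair) : bool :=
  uniq (x.1 ++ x.2) && all (mem A) (x.1 ++ x.2).

Lemma spells_in_cons1 A m I J :
  spells_in A (m :: I, J) = (m \in A) && spells_in (A :\ m) (I, J).
Proof.
rewrite /spells_in /=; have [mA|] := boolP (m \in A); last by rewrite andbF.
rewrite /= -andbA andbCA; case: (uniq _) => //=.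
rewrite -has_pred1 -all_predC -all_predI; apply: eq_all => x /=.
by rewrite !inE.
Qed.

Lemma spells_in_perm A x y : perm_eq (x.1 ++ x.2) (y.1 ++ y.2) ->
  spells_in A x = spells_in A y.
Proof. by move=> e; rewrite /spells_in (perm_uniq e) (perm_all _ e). Qed.

Lemma spells_in_cons2 A m I J :
  spells_in A (I, m :: J) = (m \in A) && spells_in (A :\ m) (I, J).
Proof.
rewrite -spells_in_cons1; apply: spells_in_perm => /=.
by rewrite perm_catC /= -cat1s -[X in perm_eq _ X]cat1s perm_cat2l perm_catC.
Qed.

Variables (C : pzRingType) (V : lmodType C).

Lemma sum_word_pairs1 d A (Phi : wpair -> V) :
  \sum_(x <- word_pairs d.+1 | spells_in A x) Phi x =
  \sum_(m in A) \sum_(x <- word_pairs d | spells_in (A :\ m) x)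
     Phi (m :: x.1, x.2)
  + \sum_(J <- words d.+1 | spells_in A ([::], J)) Phi ([::], J).
Proof.
rewrite big_cat big_map; congr (_ + _); rewrite big_mkcond big_allpairs_dep /=.
rewrite big_enum [RHS]big_mkcond; apply: eq_bigr => m _.
rewrite -big_mkcond /=.
under eq_bigl => x do rewrite spells_in_cons1 -surjective_pairing.
by case: (m \in A) => //; rewrite big_pred0.
Qed.

Lemma sum_word_pairs2 d A (Phi : wpair -> V) :
  \sum_(x <- word_pairs d.+1 | spells_in A x) Phi x =
  \sum_(m in A) \sum_(x <- word_pairs d | spells_in (A :\ m) x)
     Phi (x.1, m :: x.2)
  + \sum_(I <- words d.+1 | spells_in A (I, [::])) Phi (I, [::]).
Proof.
rewrite (perm_big _ (word_pairs_perm d)) /= big_cat big_map; congr (_ + _).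
rewrite big_mkcond big_allpairs_dep /=.
rewrite big_enum [RHS]big_mkcond; apply: eq_bigr => m _.
rewrite -big_mkcond /=.
under eq_bigl => x do rewrite spells_in_cons2 -surjective_pairing.
by case: (m \in A) => //; rewrite big_pred0.
Qed.

End Words.

(** * The two-site identity *)

Section TwoSites.
Variables (C : fieldType) (l : nat) (t : 'I_l -> C) (z1 z2 : C).
Local Notation L := 'I_l.
Local Notation wpair := (seq L * seq L)%type.
Hypotheses (t_inj : injective t) (tz1 : forall m, t m != z1)
  (tz2 : forall m, t m != z2).
Variables (V : lmodType C) (f1 f2 : L -> {linear V -> V}) (Om : {linear V -> V})
  (h : L -> {linear V -> V}) (v0 : V) (lamb : L -> C) (al : L -> L -> C).

(** In the application [f1] and [f2] are the even operators at sites i and j, [Om] is H_ij and [h m]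
    is the coroot at j. [Om_kill] reflects that raising operators at j kill [v0]. *)
Let F (x : wpair) : V := foldr f1 (foldr f2 v0 x.2) x.1.

Hypotheses (f12 : forall m r w, f1 m (f2 r w) = f2 r (f1 m w))
  (Om_comm : forall m w,
     Om (f1 m w + f2 m w) = f1 m (Om w) + f2 m (Om w) + f1 m (h m w))
  (h_weight : forall m x,
     h m (F x) = (lamb m - \sum_(r <- x.2) al m r) *: F x)
  (Om_kill : forall I, Om (F (I, [::])) = 0).

Let hd z (s : seq L) := head z [seq t j | j <- s].

(* The pair (s, u) is a homogeneous coordinate: (1, u) anchors both words at
   the finite point u, and (0, 1) is u = oo, where the anchors disappear and
   the coefficients of the weight function remain. *)
Definition pair_coef (s u : C) (x : wpair) : C :=
  (u - s * hd z1 x.1)^-1 * omega1 t z1 x.1 *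
  ((u - s * hd z2 x.2)^-1 * omega1 t z2 x.2).

(** At (0, 1) this is Q of the two words. Homogenizing makes it a linear form in (s, u). *)
Definition pair_factor (s u : C) (x : wpair) : C :=
  \sum_(m <- x.1) (t m - z1) * ((u - s * z2) / (t m - z2) * lamb m
     + \sum_(r <- x.2) (u - s * t r) / (t r - t m) * al m r).

Lemma pair_factor_lin s u x :
  pair_factor s u x = u * pair_factor 0 1 x + s * pair_factor 1 0 x.
Proof.
rewrite /pair_factor !mulr_sumr -big_split; apply: eq_bigr => m _ /=.
set S0 := \sum_(r <- _) _; set S1 := \sum_(r <- _) _; set S2 := \sum_(r <- _) _.
suff -> : S0 = u * S1 + s * S2 by ring.
rewrite /S0 /S1 /S2 !mulr_sumr -big_split; apply: eq_bigr => r _ /=; ring.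
Qed.

(** A linear form in (s, u) is interpolated from its values at (1, X) and (1, Y). This is the
    counterpart for eigenvalues of the partial fractions used for the coefficients. *)
Lemma pair_factor_interp s u X Y x :
  pair_factor s u x * (X - Y) =
  pair_factor 1 X x * (u - s * Y) - pair_factor 1 Y x * (u - s * X).
Proof.
rewrite pair_factor_lin (pair_factor_lin 1 X) (pair_factor_lin 1 Y); ring.
Qed.

(** At the anchor t_m the quotients of the new letter become 1 and -1, leaving t_m - z1 times the
    coroot eigenvalue on the second word: the commutator term of [Om_comm]. *)
Lemma pair_factor_cons1 m I J : m \notin J ->
  pair_factor 1 (t m) (m :: I, J) = pair_factor 1 (t m) (I, J)
    + (t m - z1) * (lamb m - \sum_(r <- J) al m r).
Proof.
move=> mJ; rewrite /pair_factor /= big_cons addrC; congr (_ + _ * (_ + _)).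
  by rewrite mul1r divff ?mul1r // subr_eq0.
rewrite -sumrN big_seq [RHS]big_seq; apply: eq_bigr => r rJ.
rewrite mul1r -opprB mulNr divff ?mulN1r // subr_eq0 (inj_eq t_inj).
by apply: contraNneq mJ => <-.
Qed.

Lemma pair_factor_cons2 r I J :
  pair_factor 1 (t r) (I, r :: J) = pair_factor 1 (t r) (I, J).
Proof.
rewrite /pair_factor /=; apply: eq_bigr => m _; rewrite big_cons.
by rewrite !mul1r subrr !mul0r add0r.
Qed.

Lemma pair_factor_nil1 s u J : pair_factor s u ([::], J) = 0.
Proof. by rewrite /pair_factor big_nil. Qed.

Lemma pair_factor_nil2 I : pair_factor 1 z2 (I, [::]) = 0.
Proof.
rewrite /pair_factor big1 // => m _.
by rewrite big_nil mul1r subrr !mul0r addr0 mulr0.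
Qed.

Lemma pair_coefE s u I J : pair_coef s u (I, J) =
  (u - s * hd z1 I)^-1 * omega1 t z1 I * ((u - s * hd z2 J)^-1 * omega1 t z2 J).
Proof. by []. Qed.

Lemma pair_coef_cons1 m I J : pair_coef 1 (t m) (I, J) =
  omega1 t z1 (m :: I) * omega1 t z2 J / (t m - hd z2 J).
Proof. by rewrite /pair_coef /= -/(hd z1 I) !mul1r mulrA mulrAC. Qed.

Lemma pair_coef_cons2 r I J : pair_coef 1 (t r) (I, J) =
  omega1 t z1 I * omega1 t z2 (r :: J) / (t r - hd z1 I).
Proof. by rewrite /pair_coef /= -/(hd z2 J) !mul1r; ring. Qed.

Lemma F_cons1 m I J : F (m :: I, J) = f1 m (F (I, J)).
Proof. by []. Qed.

Lemma F_cons2 r I J : F (I, r :: J) = f2 r (F (I, J)).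
Proof. by elim: I => //= m I IH; rewrite !F_cons1 IH f12. Qed.

Definition peel1 (g : L -> wpair -> C) (x : wpair) : C :=
  if x.1 is m :: s then g m (s, x.2) else 0.
Definition peel2 (g : L -> wpair -> C) (x : wpair) : C :=
  if x.2 is m :: s then g m (x.1, s) else 0.

(** Pairs led by m in the first word and pairs led by m in the second have the same remainders, so
    [f1 m] and [f2 m] act on the same vectors, as [Om_comm] demands. *)
Lemma sum_peel d A (g1 g2 : L -> wpair -> C) :
  \sum_(x <- word_pairs L d.+1 | spells_in A x)
    (peel1 g1 x + peel2 g2 x) *: F x =
  \sum_(m in A) \sum_(x <- word_pairs L d | spells_in (A :\ m) x)
    (g1 m x *: f1 m (F x) + g2 m x *: f2 m (F x)).
Proof.
under eq_bigr do rewrite scalerDl; rewrite big_split /=.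
rewrite sum_word_pairs1 [X in _ + X = _]sum_word_pairs2 /=.
rewrite [X in _ + X + _]big1 => [|J _]; last by rewrite scale0r.
rewrite [X in _ + (_ + X)]big1 => [|J _]; last by rewrite scale0r.
rewrite !addr0 -big_split; apply: eq_bigr => m _; rewrite -big_split /=.
by apply: eq_bigr => -[I J] _; rewrite F_cons1 F_cons2.
Qed.

Lemma spells_in_neq (A : {set L}) m r I J :
  spells_in A (m :: I, r :: J) -> m != r.
Proof.
rewrite /spells_in /= => /andP[/andP[+ _] _].
by rewrite mem_cat inE !negb_or => /and3P[].
Qed.

(** The point (s, u) makes the induction possible: once m is peeled off, a sum of the same shape
    remains, anchored at (1, t_m). The case wanted is (0, 1). *)
Lemma pair_sum_eigen d (A : {set L}) s u :
    u - s * z1 != 0 -> u - s * z2 != 0 ->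
    (forall m, m \in A -> u - s * t m != 0) ->
  Om (\sum_(x <- word_pairs L d | spells_in A x)
        ((u - s * z1) * pair_coef s u x) *: F x) =
  \sum_(x <- word_pairs L d | spells_in A x)
     (pair_factor s u x * pair_coef s u x) *: F x.
Proof.
elim: d A s u => [|d IH] A s u u1 u2 uA.
  rewrite /= !big_cons !big_nil pair_factor_nil1 mul0r scale0r !addr0.
  by case: (spells_in _ _); rewrite ?linear0 // linearZ /= Om_kill scaler0.
pose e (x : wpair) m := lamb m - \sum_(r <- x.2) al m r.
pose k m (x : wpair) := (t m - z1) * pair_coef 1 (t m) x.
pose q m (x : wpair) := pair_factor 1 (t m) x * pair_coef 1 (t m) x.
pose i m := (u - s * t m)^-1.
pose g m (x : wpair) := i m * k m x.
pose g1 m (x : wpair) := i m * (q m x + k m x * e x m).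
pose g2 m (x : wpair) := i m * q m x.
(* Partial fractions in u express the coefficient through those anchored at the leading letters. An
   empty second word is exempt, since [Om] kills both sides; hence the equality only under [Om]. *)
have ueq x : spells_in A x ->
    Om (((u - s * z1) * pair_coef s u x) *: F x) =
    Om ((peel1 g x + peel2 g x) *: F x).
  case: x => [w [|r J]] xA; first by rewrite !linearZ /= Om_kill !scaler0.
  congr (Om (_ *: _)); rewrite /peel2 /peel1 /g /k /i /=.
  rewrite pair_coef_cons2 pair_coefE.
  have ur : u - s * t r != 0.
    by apply: uA; move: xA; rewrite spells_in_cons2 => /andP[].
  case: w xA => [|m I] xA.
    move: (omega1 t z2 _) => b.
    by rewrite add0r /hd /=; field; rewrite subr_eq0 tz1 u1 ur.
  have um : u - s * t m != 0.
    by apply: uA; move: xA; rewrite spells_in_cons1 => /andP[].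
  have mr : t m - t r != 0.
    by rewrite subr_eq0 (inj_eq t_inj) (spells_in_neq xA).
  rewrite pair_coef_cons1 /hd [head _ _]/= [head z2 _]/=.
  move: (omega1 t z1 (m :: I)) (omega1 t z2 (r :: J)) => a b.
  by field; rewrite um ur mr -opprB oppr_eq0 mr.
(* The same splitting of the eigenvalue side, interpolating between the two leading letters. An
   empty second word provides the node z2, where the factor at the second node vanishes. *)
have qeq x : spells_in A x -> x \in word_pairs L d.+1 ->
    pair_factor s u x * pair_coef s u x = peel1 g1 x + peel2 g2 x.
  case: x => w v xA xd; rewrite /peel1 /peel2 /g1 /g2 /q /k /i /=.
  case: w v xA xd => [|m I] [|r J] xA xd.
  - by rewrite mem_word_pairs in xd.
  - by rewrite /= !pair_factor_nil1 !mul0r mulr0 addr0.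
  - have um : u - s * t m != 0.
      by apply: uA; move: xA; rewrite spells_in_cons1 => /andP[].
    have tm2 : t m - z2 != 0 by rewrite subr_eq0.
    have /esym := pair_factor_cons1 I (isT : m \notin [::]).
    rewrite /e pair_coef_cons1 pair_coefE => E.
    have := pair_factor_interp s u (t m) z2 (m :: I, [::]).
    rewrite pair_factor_nil2 mul0r subr0 -E => {}E.
    rewrite addr0; apply: (mulIf tm2); rewrite mulrAC E.
    move: (omega1 t z1 _) => a.
    by rewrite /hd /=; field; rewrite um u2 tm2.
  - have um : u - s * t m != 0.
      by apply: uA; move: xA; rewrite spells_in_cons1 => /andP[].
    have ur : u - s * t r != 0.
      by apply: uA; move: xA; rewrite spells_in_cons2 => /andP[].
    have mr : t m - t r != 0.
      by rewrite subr_eq0 (inj_eq t_inj) (spells_in_neq xA).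
    have mJ : m \notin r :: J.
      move: xA; rewrite /spells_in /= mem_cat negb_or -andbA.
      by case/andP=> /andP[].
    rewrite pair_coef_cons1 pair_coef_cons2 pair_coefE /e.
    have := pair_factor_interp s u (t m) (t r) (m :: I, r :: J).
    rewrite (pair_factor_cons1 _ mJ) pair_factor_cons2.
    rewrite /hd [head _ _]/= [head z2 _]/= => E.
    apply: (mulIf mr); rewrite mulrAC E.
    move: (omega1 t z1 (m :: I)) (omega1 t z2 (r :: J)) => a b.
    by rewrite /=; field; rewrite um ur mr -opprB oppr_eq0 mr.
transitivity (Om (\sum_(x <- word_pairs L d.+1 | spells_in A x)
                    (peel1 g x + peel2 g x) *: F x)).
  by rewrite !linear_sum; apply: eq_bigr => x /ueq.
rewrite [RHS]big_seq_cond.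
under [RHS]eq_bigr => x /andP[xd xA] do rewrite qeq //.
rewrite -big_seq_cond !sum_peel linear_sum; apply: eq_bigr => m mA.
under eq_bigr do rewrite -!(scalerA (i m)) -scalerDr.
rewrite -scaler_sumr linearZ /= big_split /=.
have mE (f : {linear V -> V}) (c : wpair -> C) :
    \sum_(x <- word_pairs L d | spells_in (A :\ m) x) c x *: f (F x) =
    f (\sum_(x <- word_pairs L d | spells_in (A :\ m) x) c x *: F x).
  by rewrite linear_sum; apply: eq_bigr => x _; rewrite linearZ.
have IHm : Om (\sum_(x <- word_pairs L d | spells_in (A :\ m) x) k m x *: F x)
    = \sum_(x <- word_pairs L d | spells_in (A :\ m) x) q m x *: F x.
  rewrite -IH ?mul1r ?subr_eq0 // => r; rewrite in_setD1 => /andP[rm _].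
  by rewrite mul1r subr_eq0 (inj_eq t_inj) eq_sym.
(* The commutator term f1 m (h m ...) accounts for the summand with [e] in [g1]. *)
rewrite !mE Om_comm IHm.
under [RHS]eq_bigr => x _ do rewrite /g1 /g2 -!(scalerA (i m)) -scalerDr.
rewrite -scaler_sumr; congr (_ *: _); rewrite big_split /=.
under [X in _ = X + _]eq_bigr do rewrite scalerDl.
rewrite big_split /= !mE addrAC; congr (_ + _ + _).
congr (f1 m _); rewrite linear_sum; apply: eq_bigr => x _.
by rewrite linearZ /= h_weight scalerA.
Qed.
End TwoSites.

(** * Operators at one site *)

Section SiteOperators.
Variables (C : fieldType) (r : nat) (par : 'I_r.+1 -> bool) (N : nat)
  (M : 'I_N -> glmod C par).
Local Notation tindex := {dffun forall k : 'I_N, 'I_(mdim (M k))}.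
Local Notation T := (tens M).

Definition upd (y : tindex) k (m : 'I_(mdim (M k))) : tindex :=
  finfun (dfwith y m).
Arguments upd y k m : clear implicits.

Lemma updE y k m : upd y k m k = m.
Proof. by rewrite ffunE dfwith_in. Qed.

Lemma updN y k m j : k != j -> upd y k m j = y j.
Proof. by move=> kj; rewrite ffunE dfwith_out. Qed.

Lemma tensD (f g : T) y : (f + g) y = f y + g y.
Proof. by rewrite ffunE. Qed.

Lemma tensN (f : T) y : (- f) y = - f y.
Proof. by rewrite ffunE. Qed.

Lemma tensZ c (f : T) y : (c *: f) y = c * f y.
Proof. by rewrite ffunE. Qed.

Lemma upd_upd y k m m' : upd (upd y k m) k m' = upd y k m'.
Proof.
apply/ffunP=> j; have [<-|kj] := eqVneq k j; first by rewrite !updE.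
by rewrite !updN.
Qed.

Lemma updC y k k' m m' : k != k' ->
  upd (upd y k m) k' m' = upd (upd y k' m') k m.
Proof.
move=> kk'; apply/ffunP=> j.
have [<-|kj] := eqVneq k j; first by rewrite updN 1?eq_sym // !updE.
have [<-|k'j] := eqVneq k' j; first by rewrite updE updN // updE.
by rewrite !updN.
Qed.

Definition lparity (k : 'I_N) (y : tindex) : nat :=
  (\sum_(j < N | (j < k)%N) mpar (y j))%N.

Lemma lparity_upd y (k k' : 'I_N) m : (k <= k')%N ->
  lparity k (upd y k' m) = lparity k y.
Proof.
move=> kk'; apply: eq_bigr => j jk; rewrite updN //.
by apply: contraL jk => /eqP<-; rewrite -leqNgt.
Qed.

Lemma sign_lparity_upd y (k k' : 'I_N) m : (k' < k)%N ->
  (-1) ^+ lparity k (upd y k' m) =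
  (-1) ^+ lparity k y * (-1) ^+ (mpar (y k') (+) mpar m) :> C.
Proof.
move=> kk'; rewrite /lparity (bigD1 k') //= [in RHS](bigD1 k') //= updE.
rewrite !exprD mulrAC -signr_addb addbA addbb addFb; congr (_ * _).
congr (_ ^+ _); apply: eq_bigr => j /andP[_ /negPf jk].
by rewrite updN // eq_sym jk.
Qed.

Lemma EsiteE k a b (f : T) y : Esite k a b f y =
  \sum_m (-1) ^+ ((par a (+) par b) * lparity k y)%N
    * act (M k) a b (y k) m * f (upd y k m).
Proof.
rewrite ffunE (reindex_onto (upd y k) (fun x : tindex => x k)) /=.
  apply: eq_big => [m|m _].
    rewrite updE eqxx andbT; apply/forallP => j; apply/implyP => jk.
    by rewrite updN // eq_sym.
  rewrite updE; congr (_ ^+ (_ * _) * _ * _).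
  by rewrite -[LHS]/(lparity k (upd y k m)) lparity_upd.
move=> x /forallP xy; apply/ffunP=> j; have [<-|kj] := eqVneq k j.
  by rewrite updE.
by rewrite updN //; have := xy j; rewrite eq_sym kj => /eqP.
Qed.

Lemma Esite_linear k a b : linear (@Esite C r par N M k a b : T -> T).
Proof.
move=> c f g; apply/ffunP=> y; rewrite [RHS]ffunE [X in _ = X + _]ffunE !EsiteE.
rewrite /GRing.scale /= mulr_sumr -big_split; apply: eq_bigr => m _ /=.
by rewrite !ffunE /GRing.scale /=; ring.
Qed.

Definition dsign (a b c d : 'I_r.+1) : C :=
  (-1) ^+ ((par a (+) par b) && (par c (+) par d)).

Lemma signM (b b' : bool) : (-1) ^+ (b * b')%N = (-1) ^+ (b && b') :> C.
Proof. by rewrite mulnb. Qed.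

(** E_ab at i shifts the parity of the i-th coordinate by |a| + |b|, and this coordinate enters the
    sign of the operator at j. *)
Lemma Esite_supercomm_lt (i j : 'I_N) a b c d (f : T) : (i < j)%N ->
  Esite i a b (Esite j c d f) = dsign a b c d *: Esite j c d (Esite i a b f).
Proof.
move=> ij; have nij : i != j by rewrite neq_ltn ij.
apply/ffunP=> y; rewrite [RHS]ffunE !EsiteE /GRing.scale /= mulr_sumr.
under eq_bigr => m _ do rewrite EsiteE mulr_sumr.
under [RHS]eq_bigr => m _ do rewrite EsiteE mulr_sumr mulr_sumr.
rewrite exchange_big; apply: eq_bigr => m' _; apply: eq_bigr => m _ /=.
rewrite updC // (updN _ _ nij) (@updN y j) 1?eq_sym //.
rewrite (lparity_upd _ _ (ltnW ij)).
have [A0|/act_homog yi] := eqVneq (act (M i) a b (y i) m) 0.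
  by rewrite A0 !(mul0r, mulr0).
have -> : (-1) ^+ ((par c (+) par d) * lparity j (upd y i m))%N =
    (-1) ^+ ((par c (+) par d) * lparity j y)%N * dsign a b c d :> C.
  rewrite /dsign -signM !exprM; case: (par c (+) par d) => /=.
    rewrite !expr1 sign_lparity_upd // yi.
    case: (par a); case: (par b); case: (mpar m) => /=;
      by rewrite ?mulr1 ?muln1.
  by rewrite !expr0 ?expr1n mulr1.
ring.
Qed.

Lemma dsignK a b c d : dsign a b c d * dsign a b c d = 1.
Proof. by rewrite -expr2 sqrr_sign. Qed.

Lemma Esite_supercomm (i j : 'I_N) a b c d (f : T) : i != j ->
  Esite i a b (Esite j c d f) = dsign a b c d *: Esite j c d (Esite i a b f).
Proof.
rewrite neq_ltn => /orP[/Esite_supercomm_lt //|/Esite_supercomm_lt ->].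
by rewrite scalerA /dsign [in X in _ * X]andbC dsignK scale1r.
Qed.

Lemma Esite_bracket (i : 'I_N) a b c d (f : T) :
  Esite i a b (Esite i c d f) = dsign a b c d *: Esite i c d (Esite i a b f)
    + (b == c)%:R *: Esite i a d f
    - dsign a b c d *: ((a == d)%:R *: Esite i c b f).
Proof.
have comp a' b' c' d' y : Esite i a' b' (Esite i c' d' f) y =
  \sum_m (-1) ^+ (((par a' (+) par b') + (par c' (+) par d')) * lparity i y)%N
     * (act (M i) a' b' *m act (M i) c' d') (y i) m * f (upd y i m).
  rewrite EsiteE; under eq_bigr => m _ do rewrite EsiteE mulr_sumr.
  rewrite exchange_big; apply: eq_bigr => m' _ /=.
  rewrite mxE mulr_sumr mulr_suml; apply: eq_bigr => m _.
  rewrite upd_upd updE lparity_upd // mulnDl exprD; ring.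
apply/ffunP=> y; rewrite !(tensD, tensN, tensZ) !comp !EsiteE.
rewrite !mulr_sumr -sumrN -!big_split; apply: eq_bigr => m _ /=.
have := act_bracket (M i) a b c d; rewrite -/(dsign a b c d) => /matrixP.
move=> /(_ (y i) m); rewrite !mxE => /eqP; rewrite subr_eq => /eqP E.
rewrite E [(_ + (par a (+) par b))%N]addnC.
(* When the Kronecker delta is 1, the resulting unit E_ad or E_cb has the parity of the product, so
   the signs from the factors on the left agree. *)
have sgE (x p p' q' : bool) n : (x -> p (+) p' = q') ->
    x%:R * (-1) ^+ (q' * n)%N = x%:R * (-1) ^+ ((p + p') * n)%N :> C.
  case: x => [/(_ isT) <-|]; last by rewrite !mul0r.
  by rewrite -signr_odd -[in RHS]signr_odd !oddM !oddD !oddb.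
have B := sgE (b == c) (par a (+) par b) (par c (+) par d) (par a (+) par d).
have A := sgE (a == d) (par a (+) par b) (par c (+) par d) (par c (+) par b).
rewrite ![(b == c)%:R * (_ * _)]mulrA ![(a == d)%:R * (_ * _)]mulrA.
rewrite A; last first.
  by move/eqP->; case: (par d); case: (par b); case: (par c).
rewrite B; last by move/eqP->; case: (par a); case: (par d); case: (par c).
ring.
Qed.

Lemma pure_Esite (k : 'I_N) a b (u : forall k, 'cV[C]_(mdim (M k)))
    (p : 'I_N -> bool) :
    (forall j : 'I_N, (j < k)%N -> homogeneous (p j) (u j)) ->
  Esite k a b (pure u) =
  (-1) ^+ ((par a (+) par b) * \sum_(j < N | (j < k)%N) p j)%N *:
    pure (dfwith u (act (M k) a b *m u k)).
Proof.
move=> hu; apply/ffunP=> y; rewrite EsiteE tensZ !ffunE.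
rewrite [X in _ = _ * X](bigD1 k) //= dfwith_in mxE mulr_suml mulr_sumr.
apply: eq_bigr => m _; rewrite ffunE (bigD1 k) //= updE.
under eq_bigr => j jk do rewrite updN 1?eq_sym //.
under [X in _ = _ * (_ * X)]eq_bigr => j jk do rewrite dfwith_out 1?eq_sym //.
(* A zero entry left of k makes both sides 0. Otherwise homogeneity fixes all parities on the left,
   and the sign no longer depends on [y]. *)
case: (boolP [exists j : 'I_N, (j < k)%N && (u j (y j) 0 == 0)]).
  case/existsP=> j /andP[jk /eqP uj].
  by rewrite (bigD1 j) ?neq_ltn ?jk //= uj !(mul0r, mulr0).
rewrite negb_exists => /forallP ujk.
have -> : lparity k y = (\sum_(j < N | (j < k)%N) p j)%N.
  apply: eq_bigr => j jk; rewrite (hu j jk) //.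
  by have := ujk j; rewrite jk.
ring.
Qed.

End SiteOperators.

(** * Half Casimir operators *)

Section Casimir.
Variables (C : fieldType) (r : nat) (par : 'I_r.+1 -> bool) (N : nat)
  (M : 'I_N -> glmod C par).
Local Notation T := (tens M).

HB.instance Definition _ k a b :=
  GRing.isLinear.Build C T T *:%R (@Esite C r par N M k a b)
    (Esite_linear k a b).

Definition Fsite k s : T -> T := Esite k (hi s) (lo s).

HB.instance Definition _ k s := GRing.Linear.on (Fsite k s).

Definition half_casimir (i j : 'I_N) (f : T) : T :=
  \sum_(a < r.+1) \sum_(b < r.+1 | (b < a)%N)
     (-1) ^+ par b *: Esite i a b (Esite j b a f).

(** The Cartan element that the form identifies with alpha_s; on weight mu it acts by (alpha_s,
    mu). *)
Definition coroot (j : 'I_N) s (f : T) : T :=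
  (-1) ^+ par (lo s) *: Esite j (lo s) (lo s) f
  - (-1) ^+ par (hi s) *: Esite j (hi s) (hi s) f.

Lemma half_casimir_linear i j : linear (half_casimir i j).
Proof.
move=> c f g; rewrite /half_casimir scaler_sumr -big_split.
apply: eq_bigr => a _; rewrite scaler_sumr -big_split; apply: eq_bigr => b _.
by rewrite !linearP.
Qed.

HB.instance Definition _ i j :=
  GRing.isLinear.Build C T T *:%R (half_casimir i j) (half_casimir_linear i j).

Lemma coroot_linear j s : linear (coroot j s).
Proof.
move=> c f g; rewrite /coroot scalerBr addrACA -opprD.
by congr (_ - _); rewrite !linearP.
Qed.

HB.instance Definition _ j s :=
  GRing.isLinear.Build C T T *:%R (coroot j s) (coroot_linear j s).

Lemma Fsite_weight k s a (f : T) :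
  Esite k a a (Fsite k s f) =
  Fsite k s (Esite k a a f) - simple_root C s 0 a *: Fsite k s f.
Proof.
rewrite /Fsite Esite_bracket /dsign addbb andFb expr0 !scale1r -addrA.
congr (_ + _); rewrite !mxE /= scalerBl opprB.
congr (_ - _); first by case: eqVneq => [->|]; rewrite ?scale0r.
by case: eqVneq => [->|]; rewrite ?scale0r.
Qed.

Lemma sum_hi_lo (V : zmodType) s (g : 'I_r.+1 -> V) :
  \sum_(b < r.+1 | (b < hi s)%N) g b =
  g (lo s) + \sum_(b < r.+1 | (b < lo s)%N) g b.
Proof.
rewrite (bigD1 (lo s)) //=.
congr (_ + _); apply: eq_bigl => b; rewrite -val_eqE /= /bump /= add1n ltnS.
by rewrite andbC -ltn_neqAle.
Qed.

Lemma sum_lo_hi (V : zmodType) s (g : 'I_r.+1 -> V) :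
  \sum_(a < r.+1 | (lo s < a)%N) g a =
  g (hi s) + \sum_(a < r.+1 | (hi s < a)%N) g a.
Proof.
rewrite (bigD1 (hi s)) //=.
congr (_ + _); apply: eq_bigl => b; rewrite -val_eqE /= /bump /= add1n.
by rewrite [RHS]ltn_neqAle eq_sym andbC.
Qed.

Lemma sum_delta (x : 'I_r.+1) (g : 'I_r.+1 -> T) :
  \sum_a (a == x)%:R *: g a = g x.
Proof.
rewrite (bigD1 x) //= eqxx scale1r big1 ?addr0 // => a /negPf->.
by rewrite scale0r.
Qed.

Lemma sum_lt_delta1 (x : 'I_r.+1) (g : 'I_r.+1 -> 'I_r.+1 -> T) :
  \sum_(a < r.+1) \sum_(b < r.+1 | (b < a)%N) (a == x)%:R *: g a b =
  \sum_(b < r.+1 | (b < x)%N) g x b.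
Proof. by under eq_bigr do rewrite -scaler_sumr; rewrite sum_delta. Qed.

Lemma sum_lt_delta2 (x : 'I_r.+1) (g : 'I_r.+1 -> 'I_r.+1 -> T) :
  \sum_(a < r.+1) \sum_(b < r.+1 | (b < a)%N) (b == x)%:R *: g a b =
  \sum_(a < r.+1 | (x < a)%N) g a x.
Proof.
rewrite (exchange_big_dep xpredT) //=.
by under eq_bigr do rewrite -scaler_sumr; rewrite sum_delta.
Qed.

(** The brackets with F at j and with F at i give partial sums of the same terms P_b and R_a, with
    opposite signs. As [lo s] and [hi s] are neighbours, the ranges differ by one index, and only P
    at [lo s] and R at [hi s] survive. *)
Lemma half_casimir_comm (i j : 'I_N) s (f : T) : i != j ->
  half_casimir i j (Fsite i s f + Fsite j s f) =
  Fsite i s (half_casimir i j f) + Fsite j s (half_casimir i j f)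
  + Fsite i s (coroot j s f).
Proof.
move=> ij; have ji : j != i by rewrite eq_sym.
rewrite linearD /=.
pose d a b := dsign C par a b (hi s) (lo s).
pose P b : T := (-1) ^+ par b *: Esite i (hi s) b (Esite j b (lo s) f).
pose R a : T := Esite i a (lo s) (Esite j (hi s) a f).
have dK a b x : d a b *: (d a b *: x) = x :> T.
  by rewrite scalerA dsignK scale1r.
have dC a b : d b a = d a b by rewrite /d /dsign [par b (+) _]addbC.
have -> : half_casimir i j (Fsite j s f) = Fsite j s (half_casimir i j f)
    + (\sum_(b < r.+1 | (b < hi s)%N) P b
       - \sum_(a < r.+1 | (lo s < a)%N)
           ((-1) ^+ par (lo s) * d a (lo s)) *: R a).
  rewrite /P /R -(sum_lt_delta1 (hi s)
    (fun a b => (-1) ^+ par b *: Esite i a b (Esite j b (lo s) f))).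
  rewrite -(sum_lt_delta2 (lo s) (fun a b => ((-1) ^+ par b * d a b) *:
    Esite i a b (Esite j (hi s) a f))).
  rewrite -sumrB /half_casimir linear_sum -big_split; apply: eq_bigr => a _ /=.
  rewrite linear_sum -sumrB -big_split; apply: eq_bigr => b _ /=.
  rewrite /Fsite Esite_bracket -/(d b a) dC [Esite i a b (_ - _)]linearB /=.
  rewrite [Esite i a b (_ + _)]linearD /= ![Esite i a b (_ *: _)]linearZ /=.
  rewrite (Esite_supercomm a b (hi s) (lo s) _ ij) -/(d a b) dK.
  rewrite scalerBr scalerDr linearZ /= -addrA; congr (_ + (_ - _)).
    by rewrite linearZ.
  by rewrite [Esite i a b (_ *: _)]linearZ /= !scalerA mulrC.
have -> : half_casimir i j (Fsite i s f) = Fsite i s (half_casimir i j f)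
    + (\sum_(a < r.+1 | (hi s < a)%N)
         ((-1) ^+ par (hi s) * d a (hi s)) *: R a
       - \sum_(b < r.+1 | (b < lo s)%N) P b).
  rewrite /P /R -(sum_lt_delta1 (lo s)
    (fun a b => (-1) ^+ par b *: Esite i (hi s) b (Esite j b a f))).
  rewrite -(sum_lt_delta2 (hi s) (fun a b => ((-1) ^+ par b * d a b) *:
    Esite i a (lo s) (Esite j b a f))).
  rewrite -sumrB /half_casimir linear_sum -big_split; apply: eq_bigr => a _ /=.
  rewrite linear_sum -sumrB -big_split; apply: eq_bigr => b _ /=.
  rewrite /Fsite (Esite_supercomm _ _ _ _ _ ji) -/(d b a) dC linearZ /=.
  rewrite Esite_bracket -/(d a b) [d a b *: (_ - _)]scalerBr dK.
  rewrite [d a b *: (_ + _)]scalerDr dK scalerBr scalerDr.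
  rewrite [Esite i (hi s) (lo s) (_ *: _)]linearZ /= -addrA.
  congr (_ + (_ - _)).
    by rewrite !scalerA mulrC.
  by rewrite !scalerA mulrC.
rewrite addrACA; congr (_ + _).
rewrite sum_hi_lo sum_lo_hi.
(* The signs d_(a, hi) and d_(a, lo) differ by (-1)^(|hi| + |lo|). *)
have -> :
    \sum_(a < r.+1 | (hi s < a)%N) ((-1) ^+ par (hi s) * d a (hi s)) *: R a =
    \sum_(a < r.+1 | (hi s < a)%N) ((-1) ^+ par (lo s) * d a (lo s)) *: R a.
  apply: eq_bigr => a _; congr (_ *: _); rewrite /d /dsign -!signr_addb.
  by case: (par a); case: (par (hi s)); case: (par (lo s)).
have aux (S Q p w : T) : S - Q + ((p + Q) - (w + S)) = p - w.
  by rewrite addrC opprD [p + Q + _]addrACA -[S - Q]opprB addrK.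
rewrite aux /P /R /coroot linearB !linearZ /=; congr (_ + _ *: _).
rewrite /d /dsign -signr_addb.
by case: (par (hi s)); case: (par (lo s)).
Qed.

End Casimir.

(** * The Grassmann envelope *)

Section GrassmannEnvelope.
Variables (C : fieldType) (r : nat) (par : 'I_r.+1 -> bool) (N : nat)
  (M : 'I_N -> glmod C par) (l : nat) (c : 'I_l -> 'I_r).
Local Notation T := (tens M).

(* The value at S is the coefficient of the product of the Grassmann
   generators xi_m, m in S, taken in increasing order. *)
Definition genv := {ffun {set 'I_l} -> T}.

HB.instance Definition _ := GRing.Lmodule.on genv.

Definition genv_map (A : T -> T) (w : genv) : genv := [ffun S => A (w S)].

Lemma genv_map_linear (A : {linear T -> T}) : linear (genv_map A).
Proof. by move=> a w w'; apply/ffunP=> S; rewrite !ffunE linearP. Qed.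

HB.instance Definition _ (A : {linear T -> T}) :=
  GRing.isLinear.Build C genv genv *:%R (genv_map A) (genv_map_linear A).

Local Notation Fp m := (Fpar par (c m)).

(** The sign of moving xi_m past the smaller odd letters of S. Even letters have commuting
    generators, which square to 0 as well; generators and operators F commute without sign. *)
Definition xi_sign (m : 'I_l) (S : {set 'I_l}) : C :=
  (-1) ^+ (Fp m && odd #|[set i in S | (i < m)%N && Fp i]|).

Definition xiF k m (w : genv) : genv :=
  [ffun S : {set 'I_l} => if m \in S
     then xi_sign m (S :\ m) *: Fsite k (c m) (w (S :\ m)) else 0].

Lemma xiF_linear k m : linear (xiF k m).
Proof.
move=> a w w'; apply/ffunP=> S; rewrite !ffunE; case: ifP => _.
  by rewrite linearP scalerDr !scalerA [a * _]mulrC.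
by rewrite scaler0 addr0.
Qed.

HB.instance Definition _ k m :=
  GRing.isLinear.Build C genv genv *:%R (xiF k m) (xiF_linear k m).

Lemma xi_sign_rem m m' (S : {set 'I_l}) : m' \in S ->
  xi_sign m S = (-1) ^+ [&& Fp m, Fp m' & (m' < m)%N] * xi_sign m (S :\ m').
Proof.
move=> m'S; rewrite /xi_sign -signr_addb; congr (_ ^+ (nat_of_bool _)).
case: (Fp m) => //=; set B := [set i in S | _].
have -> : [set i in S :\ m' | (i < m)%N && Fp i] = B :\ m'.
  by apply/setP=> i; rewrite /B !inE -!andbA.
by rewrite (cardsD1 m' B) oddD oddb /B inE m'S /= [Fp m' && _]andbC.
Qed.

(** For two odd letters the sign from exchanging the operators cancels the sign from exchanging the
    generators. For m = m' both sides vanish, since xi_m squares to 0. *)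
Lemma xiF_comm k k' m m' w : k != k' ->
  xiF k m (xiF k' m' w) = xiF k' m' (xiF k m w).
Proof.
move=> kk'; apply/ffunP=> S; rewrite !ffunE !inE.
have [<-|mm'] := eqVneq m m'; first by rewrite /= !linear0.
case mS: (m \in S); case m'S: (m' \in S);
  rewrite /= ?(negbTE mm') ?linear0 ?mm' /=; try by rewrite ?if_same.
rewrite !linearZ /= /Fsite (Esite_supercomm _ _ _ _ _ kk') !scalerA.
rewrite setDDl setUC -setDDl; congr (_ *: _).
have e1 := @xi_sign_rem m m' (S :\ m); have e2 := @xi_sign_rem m' m (S :\ m').
rewrite e1 ?e2 ?inE ?mS ?m'S ?mm' ?andbT //; last by rewrite eq_sym.
rewrite !setDDl [[set m; m']]setUC /dsign.
set a := xi_sign m _; set b := xi_sign m' _.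
have -> : (par (hi (c m)) (+) par (lo (c m))) &&
    (par (hi (c m')) (+) par (lo (c m'))) = Fp m && Fp m'.
  by rewrite /Fpar ![par (hi _) (+) _]addbC.
move: mm'; rewrite neq_ltn; case: ltngtP => // _ _;
  case: (Fp m); case: (Fp m') => /=; rewrite ?expr0 ?expr1; ring.
Qed.

Lemma Esite_xiF_kill (k j : 'I_N) a b m (w : genv) S : j != k ->
    (forall S', Esite j a b (w S') = 0) ->
  Esite j a b (xiF k m w S) = 0.
Proof.
move=> jk w0; rewrite ffunE; case: ifP => _; last by rewrite linear0.
by rewrite linearZ /= /Fsite Esite_supercomm // w0 !linear0.
Qed.

Definition site_weight k (mu : 'I_r.+1 -> C) (w : genv) :=
  forall a S, Esite k a a (w S) = mu a *: w S.

Lemma site_weight_xiF k mu m w : site_weight k mu w ->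
  site_weight k (fun a => mu a - simple_root C (c m) 0 a) (xiF k m w).
Proof.
move=> wt a S; rewrite ffunE; case: ifP => _; last by rewrite linear0 scaler0.
rewrite linearZ /= Fsite_weight wt linearZ /= -scalerBl !scalerA.
by rewrite mulrC.
Qed.

Lemma site_weight_xiF_neq k j mu m w : j != k -> site_weight j mu w ->
  site_weight j mu (xiF k m w).
Proof.
move=> jk wt a S; rewrite ffunE; case: ifP => _.
  rewrite linearZ /= /Fsite Esite_supercomm // wt /dsign addbb expr0 scale1r.
  by rewrite linearZ /= !scalerA mulrC.
by rewrite linear0 scaler0.
Qed.

Definition xiword k (s : seq 'I_l) (w : genv) : genv := foldr (xiF k) w s.

Lemma xiword_comm k k' s s' w : k != k' ->
  xiword k s (xiword k' s' w) = xiword k' s' (xiword k s w).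
Proof.
move=> kk'; elim: s => //= m s ->; elim: s' => //= m' s' IH.
by rewrite xiF_comm // IH.
Qed.

Lemma site_weight_xiword k mu s w : site_weight k mu w ->
  site_weight k (fun a => mu a - \sum_(m <- s) simple_root C (c m) 0 a)
    (xiword k s w).
Proof.
move=> wt; elim: s => [|m s IH] a S /=; first by rewrite big_nil subr0.
rewrite (site_weight_xiF m IH) big_cons.
by rewrite [_ + \sum_(_ <- _) _]addrC opprD addrA.
Qed.

Lemma site_weight_xiword_neq k j mu s w : j != k -> site_weight j mu w ->
  site_weight j mu (xiword k s w).
Proof. by move=> jk wt; elim: s => //= m s; apply: site_weight_xiF_neq. Qed.

Lemma xiword_kill (k j : 'I_N) a b s (w : genv) : j != k ->
    (forall S, Esite j a b (w S) = 0) ->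
  forall S, Esite j a b (xiword k s w S) = 0.
Proof. by move=> jk w0; elim: s => //= m s IH S; apply: Esite_xiF_kill. Qed.

Lemma wform_simple_root s (x : 'rV[C]_r.+1) :
  wform par (simple_root C s) x =
  (-1) ^+ par (lo s) * x 0 (lo s) - (-1) ^+ par (hi s) * x 0 (hi s).
Proof.
have eps_sum u : \sum_a (-1) ^+ par a * eps C u 0 a * x 0 a =
    (-1) ^+ par u * x 0 u.
  rewrite (bigD1 u) //= big1 => [|a /negPf au]; rewrite !mxE !eqxx ?au /=.
    by rewrite mulr1 addr0.
  by rewrite mulr0 mul0r.
rewrite -!eps_sum -sumrB; apply: eq_bigr => a _.
by rewrite /simple_root !mxE; ring.
Qed.

Lemma coroot_weight j mu (w : genv) s :
  site_weight j mu w ->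
  genv_map (coroot j s) w = wform par (simple_root C s) (\row_a mu a) *: w.
Proof.
move=> wt; apply/ffunP=> S; rewrite !ffunE /coroot !wt wform_simple_root !mxE.
by rewrite scalerBl !scalerA.
Qed.

Lemma genv_half_casimir_comm (i j : 'I_N) m w : i != j ->
  genv_map (half_casimir i j) (xiF i m w + xiF j m w) =
  xiF i m (genv_map (half_casimir i j) w)
  + xiF j m (genv_map (half_casimir i j) w)
  + xiF i m (genv_map (coroot j (c m)) w).
Proof.
move=> ij; apply/ffunP=> S; rewrite !ffunE; case: ifP => _.
  by rewrite -scalerDr linearZ /= half_casimir_comm // !scalerDr.
by rewrite !addr0 linear0.
Qed.

(** The two-site identity at (s, u) = (0, 1). The vector [w] is meant to carry the letters of all
    other sites. *)
Lemma half_casimir_xiword_eigen (t : 'I_l -> C) (z1 z2 : C) (i j : 'I_N)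
    (mu : 'rV[C]_r.+1) (w : genv) d (A : {set 'I_l}) :
    injective t -> (forall m, t m != z1) -> (forall m, t m != z2) ->
    i != j -> site_weight j (mu 0) w ->
    (forall (a b : 'I_r.+1) S, (a < b)%N -> Esite j a b (w S) = 0) ->
  genv_map (half_casimir i j)
    (\sum_(x <- word_pairs 'I_l d | spells_in A x)
      (omega1 t z1 x.1 * omega1 t z2 x.2) *: xiword i x.1 (xiword j x.2 w)) =
  \sum_(x <- word_pairs 'I_l d | spells_in A x)
    (pair_factor t z1 z2 (fun m => wform par (simple_root C (c m)) mu)
       (fun m m' => wform par (simple_root C (c m)) (simple_root C (c m')))
       0 1 x * (omega1 t z1 x.1 * omega1 t z2 x.2)) *:
      xiword i x.1 (xiword j x.2 w).
Proof.
move=> t_inj tz1 tz2 ij wt w0; have ji : j != i by rewrite eq_sym.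
have coefE x : pair_coef t z1 z2 0 1 x = omega1 t z1 x.1 * omega1 t z2 x.2.
  by rewrite /pair_coef !mul0r !subr0 invr1 !mul1r.
pose lamb m := wform par (simple_root C (c m)) mu.
pose al m m' := wform par (simple_root C (c m)) (simple_root C (c m')).
have hw m x : genv_map (coroot j (c m)) (xiword i x.1 (xiword j x.2 w)) =
    (lamb m - \sum_(m' <- x.2) al m m') *: xiword i x.1 (xiword j x.2 w).
  rewrite (coroot_weight _ (site_weight_xiword_neq _ ji
    (site_weight_xiword x.2 wt))); congr (_ *: _).
  rewrite /lamb /al !wform_simple_root !mxE.
  under [in RHS]eq_bigr do rewrite wform_simple_root.
  by rewrite sumrB -!mulr_sumr; ring.
(* Without letters at j, the raising operator E_ba at j passes the letters at i and kills [w]. *)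
have kill I : genv_map (half_casimir i j) (xiword i I (xiword j [::] w)) = 0.
  apply/ffunP=> S; rewrite !ffunE; apply: big1 => a _; apply: big1 => b ba.
  by rewrite (xiword_kill _ ji) ?linear0 // => S'; apply: w0.
have := @pair_sum_eigen C l t z1 z2 t_inj tz1 tz2 genv (xiF i) (xiF j)
  (genv_map (half_casimir i j)) (fun m => genv_map (coroot j (c m))) w lamb al
  (fun m m' v => xiF_comm m m' v ij)
  (fun m v => genv_half_casimir_comm m v ij) hw kill d A 0 1.
under eq_bigr do rewrite mul0r subr0 mul1r coefE.
under [in RHS]eq_bigr do rewrite coefE.
apply; rewrite ?mul0r ?subr0 ?oner_neq0 // => m _.
by rewrite mul0r subr0 oner_neq0.
Qed.

End GrassmannEnvelope.

(** * Coefficients of the Grassmann monomials, and their signs *)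

Section Evaluation.
Variables (C : fieldType) (r : nat) (par : 'I_r.+1 -> bool) (N : nat)
  (M : 'I_N -> glmod C par) (l : nat) (c : 'I_l -> 'I_r).
Local Notation T := (tens M).
Local Notation genv := (genv M l).
Local Notation Fp m := (Fpar par (c m)).
Local Notation xiF := (@xiF C r par N M l c).
Local Notation xiword := (@xiword C r par N M l c).
Local Notation xi_sign := (@xi_sign C r par l c).

Definition at_set (S : {set 'I_l}) (f : T) : genv :=
  [ffun S' => if S' == S then f else 0].

(** The sign of sorting the product of the generators, taken in word order, into increasing
    order. *)
Fixpoint reorder_sign (s : seq 'I_l) : C :=
  if s is m :: s' then xi_sign m [set i in s'] * reorder_sign s' else 1.

Definition Fword k (s : seq 'I_l) (f : T) : T :=
  foldr (fun m => Fsite k (c m)) f s.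

Lemma xiF_at_set k m (S : {set 'I_l}) f : m \notin S ->
  xiF k m (at_set S f) = at_set (m |: S) (xi_sign m S *: Fsite k (c m) f).
Proof.
move=> mS; apply/ffunP=> S'; rewrite !ffunE.
have [->|neq] := eqVneq S' (m |: S); first by rewrite setU11 setU1K ?eqxx.
case: ifP => // mS'; rewrite ifN ?linear0 ?scaler0 //.
by apply: contraNneq neq => <-; rewrite setD1K.
Qed.

Lemma xiword_at_set k s s0 f : uniq (s ++ s0) ->
  xiword k s (at_set [set i in s0] (reorder_sign s0 *: f)) =
  at_set [set i in s ++ s0] (reorder_sign (s ++ s0) *: Fword k s f).
Proof.
elim: s => //= m s IH /andP[ms us]; rewrite IH // xiF_at_set ?inE //.
by rewrite set_cons linearZ /= scalerA.
Qed.

Definition site_words (W : Type) (F : 'I_N -> seq 'I_l -> W -> W)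
    (n : 'I_N -> seq 'I_l) (ks : seq 'I_N) (w : W) : W :=
  foldr (fun k => F k (n k)) w ks.

Lemma site_words_at_set n ks f : uniq (flatten [seq n k | k <- ks]) ->
  site_words xiword n ks (at_set set0 f) =
  at_set [set i in flatten [seq n k | k <- ks]]
    (reorder_sign (flatten [seq n k | k <- ks]) *: site_words Fword n ks f).
Proof.
elim: ks => [|k ks IH] /=; first by rewrite set_nil scale1r.
move=> u; rewrite IH ?xiword_at_set //.
by move: u; rewrite cat_uniq => /and3P[].
Qed.

(** In the envelope, words at different sites commute, so any site can be brought to the front. *)
Lemma site_words_rem n ks k w : uniq ks -> k \in ks ->
  site_words xiword n ks w = xiword k (n k) (site_words xiword n (rem k ks) w).
Proof.
elim: ks => //= a ks IH /andP[aks uks]; rewrite inE.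
have [<-|ak /= kks] := eqVneq a k; first by [].
by rewrite IH // xiword_comm.
Qed.

(** Prepending m creates just the inversions (i, m) with i < m in s, whose odd ones [xi_sign]
    counts. Membership of [ij.1] is required because [index] puts a missing letter past the end,
    which would look like an inversion. *)
Lemma reorder_sign_inv (s : seq 'I_l) : uniq s ->
  reorder_sign s = (-1) ^+ #|[set ij : 'I_l * 'I_l |
      [&& ij.1 \in s, (ij.1 < ij.2)%N, Fp ij.1, Fp ij.2
        & (index ij.2 s < index ij.1 s)%N]]|.
Proof.
elim: s => [|m s IH] /=.
  by rewrite (_ : [set _ | _] = set0) ?cards0 //; apply/setP=> x; rewrite !inE.
move=> /andP[ms us]; rewrite IH //.
set B := [set ij : 'I_l * 'I_l | [&& ij.1 \in s, _, _, _ & _]].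
rewrite -[in RHS](cardsID [set ij : 'I_l * 'I_l | ij.2 == m]) exprD.
congr (_ * _ ^+ _); last first.
  apply: eq_card => -[i j]; rewrite !inE /= [m == j]eq_sym.
  have [->|jm] /= := eqVneq j m.
    by rewrite [index m s]memNindex // [(size s < _)%N]ltnNge index_size !andbF.
  rewrite [m == i]eq_sym; have [->|im] //= := eqVneq i m.
  by rewrite ltn0 (negPf ms) !andbF.
rewrite /xi_sign; have [Fm|nFm] /= := boolP (Fp m); last first.
  rewrite (_ : _ :&: _ = set0) ?cards0 //; apply/setP=> -[i j]; rewrite !inE /=.
  by have [->|jm] := eqVneq j m; rewrite ?(negPf nFm) !andbF.
rewrite signr_odd -(card_imset _ (f := fun i => (i, m))); last by move=> ? ? [].
congr (_ ^+ _); apply: eq_card => -[i j]; rewrite !inE /=.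
apply/imsetP/idP => [[i' + [-> ->]]|].
  rewrite !inE eqxx => /and3P[i's i'm Fi'].
  rewrite i's i'm Fi' Fm orbT /=. by case: eqVneq ms => [->|]; rewrite ?i's.
case/andP=> /and5P[im_s im Fi _ _] /eqP jm; exists i; last by rewrite jm.
rewrite jm in im; rewrite !inE im Fi andbT; move: im_s.
by case: eqVneq im => [->|]; rewrite ?ltnn ?andbT.
Qed.

Lemma eq_pure (u u' : forall k, 'cV[C]_(mdim (M k))) :
  (forall k, u k = u' k) -> pure u = pure u' :> T.
Proof.
move=> uu'; apply/ffunP=> x; rewrite !ffunE.
by apply: eq_bigr => k _; rewrite uu'.
Qed.

Lemma Fword_pure (k : 'I_N) s (u : forall k, 'cV[C]_(mdim (M k)))
    (p : 'I_N -> bool) :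
    (forall j : 'I_N, (j < k)%N -> homogeneous (p j) (u j)) ->
  Fword k s (pure u) =
  (-1) ^+ (\sum_(j < N | (j < k)%N) p j * count (fun m => Fp m) s)%N *:
    pure (dfwith u (Fmonomial c s (u k))).
Proof.
move=> hu; elim: s => [|m s IH] /=.
  rewrite big1 ?expr0 ?scale1r => [|j _]; last by rewrite muln0.
  by apply: eq_pure => j; case: dfwithP.
rewrite IH linearZ /= /Fsite (pure_Esite _ _ (p := p)) => [|j jk]; last first.
  by rewrite dfwith_out; [exact: hu|rewrite neq_ltn jk orbT].
rewrite scalerA; congr (_ *: _); last first.
  apply: eq_pure => j; rewrite dfwith_in.
  case: (dfwithP (dfwith u _)) => [|j' kj']; first by rewrite dfwith_in.
  by rewrite !dfwith_out.
rewrite -exprD -!big_distrl /= mulnDr addnC mulnC; congr (_ ^+ (_ * _ + _)).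
by rewrite /Fpar addbC.
Qed.

(** As [ks] increases, the rightmost site acts first, and the factors left of k are still the v_j
    when the word at k acts. So only the parities q_j enter, giving the sign of [Fvec]. *)
Lemma site_words_pure n ks (v : forall k, 'cV[C]_(mdim (M k)))
    (q : 'I_N -> bool) :
    (forall k, homogeneous (q k) (v k)) ->
    sorted (fun i j : 'I_N => (i < j)%N) ks ->
  site_words Fword n ks (pure v) =
  (-1) ^+ (\sum_(k <- ks) \sum_(j < N | (j < k)%N)
             q j * count (fun m => Fp m) (n k))%N *:
    pure (fun k => if k \in ks then Fmonomial c (n k) (v k) else v k).
Proof.
move=> hv; elim: ks => [|k ks IH] srt /=; first by rewrite big_nil scale1r.
have kks : all (fun j : 'I_N => k < j)%N ks.
  by apply: order_path_min srt => a b d; apply: ltn_trans.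
rewrite IH ?(path_sorted srt) //.
have -> a (f : T) : Fword k (n k) (a *: f) = a *: Fword k (n k) f.
  by elim: (n k) => //= m s ->; rewrite linearZ.
rewrite (Fword_pure _ (p := q)) => [|j jk]; last first.
  case: ifP => // /(allP kks) kj; by have := ltn_trans jk kj; rewrite ltnn.
rewrite scalerA big_cons -exprD addnC; congr (_ *: _); apply: eq_pure => j.
rewrite inE; case: dfwithP => [|j' kj'].
  rewrite eqxx ifN //; by apply/negP => /(allP kks); rewrite ltnn.
by rewrite eq_sym (negPf kj').
Qed.

End Evaluation.

(** * Splitting the Casimir tensor; the bilinear form on weights *)

Section CasimirSplit.
Variables (C : fieldType) (r : nat) (par : 'I_r.+1 -> bool) (N : nat)
  (M : 'I_N -> glmod C par).

(** The terms with a < b form H_ji: exchanging the two operators costs (-1)^(|a| + |b|), which turns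
    (-1)^|b| into (-1)^|a|. *)
Lemma casimir_split (i j : 'I_N) (f : tens M) : i != j ->
  \sum_a \sum_b (-1) ^+ par b *: Esite i a b (Esite j b a f) =
  \sum_a (-1) ^+ par a *: Esite i a a (Esite j a a f)
  + half_casimir i j f + half_casimir j i f.
Proof.
move=> ij; rewrite /half_casimir.
rewrite [X in _ + X](exchange_big_dep xpredT) //= -!big_split.
apply: eq_bigr => a _ /=; rewrite (bigID (fun b : 'I_r.+1 => b < a)%N) /=.
rewrite [X in _ + X](bigD1 a) ?ltnn //= addrCA addrA; congr (_ + _).
apply: eq_big => b; first by rewrite -leqNgt ltn_neqAle eq_sym andbC.
move=> _; rewrite (Esite_supercomm _ _ _ _ _ ij) scalerA; congr (_ *: _).
by rewrite /dsign -signr_addb; case: (par a); case: (par b).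
Qed.

End CasimirSplit.

Section Wform.
Variables (C : fieldType) (r : nat) (par : 'I_r.+1 -> bool).
Implicit Types x y : 'rV[C]_r.+1.

Lemma wformC x y : wform par x y = wform par y x.
Proof. by apply: eq_bigr => a _; rewrite mulrAC. Qed.

Lemma wformBl x x' y : wform par (x - x') y = wform par x y - wform par x' y.
Proof. by rewrite -sumrB; apply: eq_bigr => a _; rewrite !mxE; ring. Qed.

Lemma wformBr x y y' : wform par x (y - y') = wform par x y - wform par x y'.
Proof. by rewrite wformC wformBl ![wform par _ x]wformC. Qed.

Lemma wform_suml (I : Type) (s : seq I) (F : I -> 'rV[C]_r.+1) y :
  wform par (\sum_(i <- s) F i) y = \sum_(i <- s) wform par (F i) y.
Proof.
rewrite /wform exchange_big; apply: eq_bigr => a _ /=.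
by rewrite summxE mulr_sumr mulr_suml.
Qed.

Lemma wform_sumr (I : Type) (s : seq I) (F : I -> 'rV[C]_r.+1) y :
  wform par y (\sum_(i <- s) F i) = \sum_(i <- s) wform par y (F i).
Proof.
by rewrite wformC wform_suml; apply: eq_bigr => i _; rewrite wformC.
Qed.

End Wform.

(** The diagonal is a separate hypothesis because in characteristic 2 antisymmetry does not force it
    to vanish. *)
Lemma sum_antisym (C : pzRingType) (I : Type) (s : seq I) (g : I -> I -> C) :
    (forall m, g m m = 0) -> (forall m m', g m m' = - g m' m) ->
  \sum_(m <- s) \sum_(m' <- s) g m m' = 0.
Proof.
move=> g0 gN; elim: s => [|m s IH]; first by rewrite big_nil.
rewrite big_cons big_cons g0 add0r.
under [X in _ + X]eq_bigr do rewrite big_cons.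
rewrite big_split /= IH addr0 -big_split big1 //= => m' _.
by rewrite gN addNr.
Qed.

(** * Ordered partitions *)

Section OrderedPartitions.
Variables (N l : nat).
Local Notation op := {ffun 'I_N -> l.-bseq 'I_l}.
Local Notation OP := (ordered_partitions N l).

Lemma sum_ordered_partition (C : pzRingType) (n : op) (g : 'I_l -> C) :
  n \in OP -> \sum_k \sum_(m <- n k) g m = \sum_m g m.
Proof.
rewrite inE => nP; rewrite -[RHS]big_enum /= -(perm_big _ nP) /=.
by rewrite big_flatten big_map big_enum.
Qed.

Variables (i j : 'I_N).
Hypothesis ij : i != j.

Definition other_sites : seq 'I_N := rem j (rem i (enum 'I_N)).

Definition erase (n : op) : op :=
  [ffun k => if (k == i) || (k == j) then [bseq] else n k].

Lemma mem_other_sites k : (k \in other_sites) = (k != i) && (k != j).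
Proof.
rewrite mem_rem_uniq ?rem_uniq ?enum_uniq // inE mem_rem_uniq ?enum_uniq // inE.
by rewrite mem_enum andbT andbC.
Qed.

Lemma perm_sites : perm_eq (enum 'I_N) (i :: j :: other_sites).
Proof.
apply: (perm_trans (perm_to_rem (x := i) _)); first by rewrite mem_enum.
rewrite perm_cons perm_to_rem // mem_rem_uniq ?enum_uniq // !inE eq_sym ij.
by rewrite mem_enum.
Qed.

Lemma eraseE (n : op) k : k \in other_sites -> erase n k = n k.
Proof. by rewrite mem_other_sites ffunE -negb_or => /negPf->. Qed.

Lemma ordered_partitionE (n : op) :
  (n \in OP) = perm_eq (n i ++ n j ++
    flatten [seq val (erase n k) | k <- other_sites]) (enum 'I_l).
Proof.
rewrite inE; apply: (permPl (_ : perm_eq _ _)).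
rewrite -(_ : [seq val (n k) | k <- other_sites] =
             [seq val (erase n k) | k <- other_sites]); last first.
  by apply/eq_in_map => k /eraseE->.
exact: (perm_flatten (perm_map (fun k => val (n k)) perm_sites)).
Qed.

(** Fixing the words at the other sites leaves the letters [A], and a fibre of [erase] consists of
    all ways to spell [A] at i and j. The two-site identity thus applies fibre by fibre. *)
Lemma sum_fiber (V : nmodType) (n0 : op) (Phi : seq 'I_l * seq 'I_l -> V) :
    n0 \in OP ->
  let R := flatten [seq val (erase n0 k) | k <- other_sites] in
  let A := [set m | m \notin R] in
  \sum_(n in OP | erase n == erase n0) Phi (val (n i), val (n j)) =
  \sum_(x <- word_pairs 'I_l #|A| | spells_in A x) Phi x.
Proof.
move=> n0P R A.
have RE n : erase n = erase n0 ->
    flatten [seq val (erase n k) | k <- other_sites] = R by move=> ->.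
have memOP n : erase n = erase n0 -> n \in OP =
    ((val (n i), val (n j)) \in word_pairs 'I_l #|A|) &&
    spells_in A (val (n i), val (n j)).
  move=> nE; rewrite ordered_partitionE RE // mem_word_pairs /spells_in /=.
  move: n0P; rewrite ordered_partitionE => n0P.
  have uR : uniq R.
    have := perm_uniq n0P; rewrite enum_uniq !cat_uniq => /and3P[_ _].
    by case/and3P.
  rewrite catA -size_cat; set s := n i ++ n j.
  apply/idP/and3P => [sR|[/eqP sz us sA]].
    have := perm_uniq sR; rewrite enum_uniq cat_uniq => /and3P[us Rs _].
    have sAE : s =i A.
      move=> m; have := perm_mem sR m; rewrite mem_enum mem_cat !inE.
      case: (boolP (m \in R)) => [mR _|_]; last by rewrite orbF => ->.
      by apply/negbTE; apply: contra Rs => ms; apply/hasP; exists m.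
    split=> //; first by rewrite -(eq_card sAE) (card_uniqP us).
    by apply/allP=> m; rewrite sAE.
  have sAE : s =i A.
    apply/subset_cardP; first by rewrite (card_uniqP us).
    by apply/subsetP => m /(allP sA).
  apply: uniq_perm; rewrite ?enum_uniq //.
    rewrite cat_uniq us uR andbT; apply/hasPn => m mR.
    by rewrite sAE inE negbK.
  by move=> m; rewrite mem_cat sAE inE mem_enum orNb.
rewrite -big_filter -[RHS]big_filter.
rewrite -(big_map (fun n : op => (val (n i), val (n j))) xpredT Phi).
apply: perm_big; apply: uniq_perm.
- rewrite map_inj_in_uniq ?filter_uniq ?index_enum_uniq // => n n'.
  rewrite !mem_filter => /andP[/andP[_ /eqP nE] _] /andP[/andP[_ /eqP nE'] _].
  case=> /val_inj ni /val_inj nj; apply/ffunP=> k.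
  have [->//|ki] := eqVneq k i; have [->//|kj] := eqVneq k j.
  have kO : k \in other_sites by rewrite mem_other_sites ki.
  by rewrite -(eraseE n kO) -(eraseE n' kO) nE nE'.
- by rewrite filter_uniq ?word_pairs_uniq.
move=> [s1 s2]; rewrite mem_filter; apply/mapP/andP => [[n]|[sA sd]].
  rewrite mem_filter => /andP[/andP[nP /eqP nE] _] ->.
  by move: nP; rewrite memOP // => /andP[].
(* The words have total length [#|A|], so both fit the bound of [l.-bseq]. *)
have sz : (size s1 + size s2 <= l)%N.
  move: (sd); rewrite mem_word_pairs => /eqP /= ->.
  by rewrite -[X in (_ <= X)%N](card_ord l) max_card.
have sz1 : (size s1 <= l)%N := leq_trans (leq_addr _ _) sz.
have sz2 : (size s2 <= l)%N := leq_trans (leq_addl _ _) sz.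
pose n : op := [ffun k => if k == i then Bseq sz1 else
                          if k == j then Bseq sz2 else n0 k].
have ni : n i = Bseq sz1 by rewrite ffunE eqxx.
have nj : n j = Bseq sz2 by rewrite ffunE eq_sym (negPf ij) eqxx.
have nE : erase n = erase n0.
  by apply/ffunP=> k; rewrite !ffunE; case: eqP => //= _; case: eqP.
exists n; last by rewrite ni nj.
by rewrite mem_filter mem_index_enum nE eqxx memOP // ni nj sd sA.
Qed.

End OrderedPartitions.

(** * The Bethe vector *)

Section BetheVector.
Variables (C : fieldType) (r : nat) (par : 'I_r.+1 -> bool) (N : nat)
  (M : 'I_N -> glmod C par) (l : nat) (c : 'I_l -> 'I_r).
Variables (z : 'I_N -> C) (t : 'I_l -> C).
Variables (v : forall k, 'cV[C]_(mdim (M k))) (q : 'I_N -> bool).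
Variable lam : 'I_N -> 'rV[C]_r.+1.
Hypotheses (v_hw : forall k, highest_weight_vector (lam k) (v k))
  (v_homog : forall k, homogeneous (q k) (v k)).
Local Notation op := {ffun 'I_N -> l.-bseq 'I_l}.
Local Notation OP := (ordered_partitions N l).
Local Notation vac := (at_set (set0 : {set 'I_l}) (pure v)).
Local Notation xiword := (@xiword C r par N M l c).
Local Notation root m := (simple_root C (c m)).
Local Notation wf := (wform par).

Definition xi_vector (n : op) : genv M l :=
  site_words xiword (fun k => val (n k)) (enum 'I_N) vac.

(** This is the coefficient of the product of all generators. Sorting them gives (-1)^|n|, and
    acting on [pure v] gives the sign of [Fvec]. *)
Lemma xi_vectorE (n : op) : n \in OP ->
  xi_vector n setT = (-1) ^+ sgn_exp par c n *: Fvec c v q n.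
Proof.
rewrite inE => nP.
have u : uniq (flatten [seq val (n k) | k <- enum 'I_N]).
  by rewrite (perm_uniq nP) enum_uniq.
have mem_n m : m \in flatten [seq val (n k) | k <- enum 'I_N].
  by rewrite (perm_mem nP) mem_enum.
rewrite /xi_vector site_words_at_set // ffunE.
rewrite (_ : [set i in _] = setT) ?eqxx; last first.
  by apply/setP=> m; rewrite !inE mem_n.
rewrite reorder_sign_inv //; congr (_ ^+ _ *: _).
  by apply: eq_card => -[m m']; rewrite !inE /= mem_n.
rewrite (site_words_pure _ _ v_homog); last first.
  by have := iota_ltn_sorted 0 N; rewrite -val_enum_ord sorted_map.
rewrite /Fvec big_enum /=; congr (_ *: _); apply: eq_pure => k.
by rewrite mem_enum.
Qed.

Lemma weight_function_xi : weight_function c z t v q =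
  (\sum_(n in OP) omega z t n *: xi_vector n) setT.
Proof.
rewrite sum_ffunE; apply: eq_bigr => n nP.
rewrite [RHS]ffunE xi_vectorE //. by rewrite [RHS]scalerA mulrC.
Qed.

Lemma pure_scale k a : pure (dfwith v (a *: v k)) = a *: pure v :> tens M.
Proof.
apply/ffunP=> x; rewrite !ffunE /GRing.scale /= (bigD1 k) //= dfwith_in.
rewrite [in RHS](bigD1 k) //= mxE mulrA; congr (_ * _).
by apply: eq_bigr => j jk; rewrite dfwith_out // eq_sym.
Qed.

Lemma vac_weight k : site_weight k (lam k 0) vac.
Proof.
move=> a S; rewrite ffunE; case: ifP => _; last by rewrite linear0 scaler0.
have [_ _ wt] := v_hw k.
rewrite (pure_Esite _ _ (p := q)) // wt pure_scale.
by rewrite addbb mul0n expr0 scale1r.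
Qed.

Lemma vac_kill k (a b : 'I_r.+1) S : (a < b)%N -> Esite k a b (vac S) = 0.
Proof.
move=> ab; rewrite ffunE; case: ifP => _; last by rewrite linear0.
have [_ kill _] := v_hw k.
rewrite (pure_Esite _ _ (p := q)) // kill //.
by have := pure_scale k 0; rewrite !scale0r => ->; rewrite scaler0.
Qed.

Lemma site_words_weight k n ks w mu : k \notin ks -> site_weight k mu w ->
  site_weight k mu (site_words xiword n ks w).
Proof.
elim: ks => //= j ks IH; rewrite inE negb_or => /andP[kj kks] wt.
exact: site_weight_xiword_neq kj (IH kks wt).
Qed.

Lemma site_words_kill k a b n ks (w : genv M l) : k \notin ks ->
    (forall S, Esite k a b (w S) = 0) ->
  forall S, Esite k a b (site_words xiword n ks w S) = 0.
Proof.
elim: ks => //= j ks IH; rewrite inE negb_or => /andP[kj kks] w0.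
exact: xiword_kill kj (IH kks w0).
Qed.

Lemma xi_vector_weight (n : op) k : site_weight k
  (fun a => (lam k - \sum_(m <- n k) root m) 0 a) (xi_vector n).
Proof.
rewrite /xi_vector (site_words_rem _ _ (k := k)) ?enum_uniq ?mem_enum // => a S.
rewrite !mxE summxE; apply: site_weight_xiword; apply: site_words_weight.
  by rewrite mem_rem_uniqF ?enum_uniq.
exact: vac_weight.
Qed.

Section Pair.
Variables (i j : 'I_N).
Hypothesis ij : i != j.

Lemma xi_vector_split (n : op) : xi_vector n =
  xiword i (n i) (xiword j (n j)
    (site_words xiword (fun k => val (erase i j n k)) (other_sites i j) vac)).
Proof.
rewrite /xi_vector (site_words_rem _ _ (k := i)) ?enum_uniq ?mem_enum //.
rewrite (site_words_rem _ _ (k := j)) ?rem_uniq ?enum_uniq //; last first.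
  by rewrite mem_rem_uniq ?enum_uniq // !inE eq_sym ij mem_enum.
congr (xiword _ _ (xiword _ _ _)); rewrite -/(other_sites i j).
(* The induction runs over lists contained in [other_sites], since [eraseE] asks for membership. *)
have : {subset other_sites i j <= other_sites i j} by [].
elim: {1 3 4}(other_sites i j) => //= k ks IH sub.
rewrite IH ?(eraseE n (sub _ (mem_head _ _))) // => k' k'ks.
by rewrite sub // inE k'ks orbT.
Qed.

Definition pair_eigenvalue (n : op) : C :=
  pair_factor t (z i) (z j) (fun m => wf (root m) (lam j))
    (fun m m' => wf (root m) (root m')) 0 1 (val (n i), val (n j)).

(** Ordered partitions are grouped by their words off i and j. Within a group the factor [om] and
    the vector [w] are common, and the two-site identity does the rest. *)
Lemma half_casimir_eigen : injective t -> (forall m k, t m != z k) ->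
  genv_map (half_casimir i j) (\sum_(n in OP) omega z t n *: xi_vector n) =
  \sum_(n in OP) (pair_eigenvalue n * omega z t n) *: xi_vector n.
Proof.
move=> t_inj tz.
rewrite (partition_big (erase i j) xpredT) //= linear_sum.
rewrite [RHS](partition_big (erase i j) xpredT) //=; apply: eq_bigr => rho _.
have [n0 /andP[n0P /eqP n0E]|none] :=
    pickP (fun n : op => (n \in OP) && (erase i j n == rho));
  last by rewrite !big_pred0 ?linear0.
rewrite -n0E.
pose w :=
  site_words xiword (fun k => val (erase i j n0 k)) (other_sites i j) vac.
pose om := \prod_(k | (k != i) && (k != j)) omega1 t (z k) (n0 k).
pose F (x : seq 'I_l * seq 'I_l) := xiword i x.1 (xiword j x.2 w).
pose om2 (x : seq 'I_l * seq 'I_l) := omega1 t (z i) x.1 * omega1 t (z j) x.2.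
have nF (n : op) : erase i j n = erase i j n0 ->
    (xi_vector n = F (val (n i), val (n j))) *
    (omega z t n = om * om2 (val (n i), val (n j))).
  move=> nE; split; first by rewrite xi_vector_split nE.
  rewrite /omega (bigD1 i) //= (bigD1 j) 1?eq_sym //= mulrA mulrC.
  congr (_ * _); apply: eq_bigr => k kij.
  have kO : k \in other_sites i j by rewrite mem_other_sites.
  by rewrite -(eraseE n kO) nE eraseE.
have ji : j != i by rewrite eq_sym.
have wwt : site_weight j (lam j 0) w.
  apply: site_words_weight (vac_weight j).
  by rewrite mem_other_sites eqxx andbF.
have wkill (a b : 'I_r.+1) S : (a < b)%N -> Esite j a b (w S) = 0.
  move=> ab; apply: site_words_kill => [|S'].
    by rewrite mem_other_sites eqxx andbF.
  exact: vac_kill.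
pose Phi1 x := om *: (om2 x *: F x).
pose q2 := pair_factor t (z i) (z j) (fun m => wf (root m) (lam j))
    (fun m m' => wf (root m) (root m')) 0 1.
pose Phi2 x := om *: ((q2 x * om2 x) *: F x).
under eq_bigr => n /andP[_ /eqP nE].
  rewrite !(nF n nE) -scalerA -/(Phi1 (val (n i), val (n j))); over.
under [RHS]eq_bigr => n /andP[_ /eqP nE].
  rewrite !(nF n nE) mulrCA -scalerA -/(Phi2 (val (n i), val (n j))); over.
rewrite !(sum_fiber ij) // -!scaler_sumr linearZ /=; congr (_ *: _).
exact: half_casimir_xiword_eigen.
Qed.

End Pair.

Lemma disjoint_words (n : op) i j m m' : n \in OP -> i != j ->
  m \in val (n i) -> m' \in val (n j) -> m != m'.
Proof.
move=> nP ij mi m'j; move: nP; rewrite (ordered_partitionE ij) => /perm_uniq.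
rewrite enum_uniq cat_uniq => /and3P[_ /hasPn nij _].
by apply: contraNneq (nij m' _) => [<-|]; rewrite ?mem_cat ?m'j.
Qed.

Lemma pair_eigenvalueE i j (n : op) : pair_eigenvalue i j n =
  \sum_(m <- n i) (t m - z i) / (t m - z j) * wf (root m) (lam j)
  + \sum_(m <- n i) \sum_(m' <- n j)
      (t m - z i) / (t m' - t m) * wf (root m) (root m').
Proof.
rewrite -big_split; apply: eq_bigr => m _ /=.
rewrite mulrDr mul0r subr0 mul1r mulrA; congr (_ + _).
by rewrite mulr_sumr; apply: eq_bigr => m' _; rewrite mul0r subr0 mul1r mulrA.
Qed.

(** Each quotient splits as (t - z_i) / (t - z_j) = 1 - (z_i - z_j) / (t - z_j), and the mixed
    quotients split likewise. The parts without the factor z_i - z_j cancel the cross terms of the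
    form of the two site weights. *)
Lemma pair_scalar (n : op) i j : n \in OP -> i != j -> injective z ->
    injective t -> (forall m k, t m != z k) ->
  (z i - z j)^-1 *
    (wf (lam i - \sum_(m <- n i) root m) (lam j - \sum_(m <- n j) root m)
     + pair_eigenvalue i j n + pair_eigenvalue j i n) =
  wf (lam i) (lam j) / (z i - z j)
  + \sum_(m <- n j) wf (lam i) (root m) / (t m - z i)
  - \sum_(m <- n i) wf (root m) (lam j) / (t m - z j)
  + \sum_(m <- n i) \sum_(m' <- n j) wf (root m) (root m') / (t m - t m').
Proof.
move=> nP ij z_inj t_inj tz.
have zij : z i - z j != 0 by rewrite subr_eq0 (inj_eq z_inj).
have tzn m k : t m - z k != 0 by rewrite subr_eq0.
have E1 : \sum_(m <- n i) (t m - z i) / (t m - z j) * wf (root m) (lam j) =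
    \sum_(m <- n i) wf (root m) (lam j)
    - (z i - z j) * \sum_(m <- n i) wf (root m) (lam j) / (t m - z j).
  by rewrite mulr_sumr -sumrB; apply: eq_bigr => m _; field.
have E2 : \sum_(m <- n j) (t m - z j) / (t m - z i) * wf (root m) (lam i) =
    \sum_(m <- n j) wf (lam i) (root m)
    + (z i - z j) * \sum_(m <- n j) wf (lam i) (root m) / (t m - z i).
  rewrite mulr_sumr -big_split; apply: eq_bigr => m _ /=.
  by rewrite wformC; field.
have E3 : \sum_(m <- n i) \sum_(m' <- n j)
      (t m - z i) / (t m' - t m) * wf (root m) (root m')
    + \sum_(m <- n j) \sum_(m' <- n i)
      (t m - z j) / (t m' - t m) * wf (root m) (root m') =
    (z i - z j) * (\sum_(m <- n i) \sum_(m' <- n j)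
       wf (root m) (root m') / (t m - t m'))
    - \sum_(m <- n i) \sum_(m' <- n j) wf (root m) (root m').
  rewrite [X in _ + X]exchange_big mulr_sumr -big_split -sumrB /=.
  rewrite big_seq [RHS]big_seq; apply: eq_bigr => m mi.
  rewrite mulr_sumr -big_split -sumrB /=.
  rewrite big_seq [RHS]big_seq; apply: eq_bigr => m' mj.
  have tm : t m - t m' != 0.
    by rewrite subr_eq0 (inj_eq t_inj) (disjoint_words nP ij).
  rewrite [wf (root m') _]wformC; field.
  by rewrite tm -opprB oppr_eq0 tm.
apply: (mulfI zij); rewrite mulVKf // !pair_eigenvalueE E1 E2.
rewrite wformBl !wformBr !wform_suml wform_sumr.
under [X in _ - (_ - X)]eq_bigr do rewrite wform_sumr.
move: E3; set D1 := \sum_(m <- n i) \sum_(m' <- n j) _ / _ * _.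
set D2 := \sum_(m <- n j) \sum_(m' <- n i) _ / _ * _ => E3.
transitivity (wf (lam i) (lam j) + (z i - z j) *
   (\sum_(m <- n j) wf (lam i) (root m) / (t m - z i)
    - \sum_(m <- n i) wf (root m) (lam j) / (t m - z j))
   + \sum_(m <- n i) \sum_(m' <- n j) wf (root m) (root m') + (D1 + D2)).
  ring.
by rewrite E3; field.
Qed.

Hypotheses (z_inj : injective z) (bethe : bethe_equations par c z t lam).

Lemma total_scalar (n : op) i : n \in OP ->
  \sum_(j < N | j != i) (z i - z j)^-1 *
    (wf (lam i - \sum_(m <- n i) root m) (lam j - \sum_(m <- n j) root m)
     + pair_eigenvalue i j n + pair_eigenvalue j i n) =
  gaudin_eigenvalue par c z t lam i.
Proof.
move=> nP; have [tz t_inj be] := bethe.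
under eq_bigr => j ji do rewrite (pair_scalar nP) 1?eq_sym //.
rewrite big_split sumrB big_split /= -!addrA; congr (_ + _).
(* Letters off site i become all letters minus those at i. In the single sum the full part belongs
   to the eigenvalue and the rest to the Bethe equations. *)
have split_i g : \sum_(j < N | j != i) \sum_(m <- n j) g m =
    \sum_m g m - \sum_(m <- n i) g m :> C.
  rewrite -(sum_ordered_partition _ nP) [in RHS](bigD1 i) //=.
  by rewrite addrAC subrr add0r.
rewrite split_i -addrA -[RHS]addr0; congr (_ + _).
rewrite !(exchange_big _ _ (n i)) /=.
under [X in _ + (_ + X)]eq_bigr do rewrite split_i.
(* The sum over m' includes m' = m, which contributes x / 0 = 0. *)
rewrite sumrB sum_antisym => [|m|m m']; last 2 first.
- by rewrite subrr invr0 mulr0.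
- by rewrite wformC -[t m - _]opprB invrN mulrN.
rewrite subr0 -!sumrN -!big_split big1 // => m _ /=.
(* What remains for m is its Bethe equation; the term s = i comes from the letters subtracted by
   [split_i]. *)
have := be m; rewrite (bigD1 i) //= => /eqP; rewrite addr_eq0 eqr_opp => /eqP E.
rewrite (bigD1 m) //= subrr invr0 mulr0 add0r -E.
by rewrite wformC; ring.
Qed.

Lemma weight_function_eigen i :
  gaudin z i (weight_function c z t v q) =
    gaudin_eigenvalue par c z t lam i *: weight_function c z t v q.
Proof.
have [tz t_inj _] := bethe.
rewrite weight_function_xi /gaudin.
set w := \sum_(n in OP) _.
have pairE j : j != i ->
    (z i - z j)^-1 *: (\sum_a \sum_b (-1) ^+ par b *:
       Esite i a b (Esite j b a (w setT))) =
    \sum_(n in OP) ((z i - z j)^-1 *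
      (wf (lam i - \sum_(m <- n i) root m) (lam j - \sum_(m <- n j) root m)
       + pair_eigenvalue i j n + pair_eigenvalue j i n) * omega z t n)
       *: xi_vector n setT.
  move=> ji; have ij : i != j by rewrite eq_sym.
  rewrite casimir_split //.
  have half i' j' : i' != j' -> half_casimir i' j' (w setT) =
      \sum_(n in OP)
        (pair_eigenvalue i' j' n * omega z t n) *: xi_vector n setT.
    (* [genv_map] acts coefficientwise, so the identity can be read off at [setT]. *)
    move=> ij'; have := half_casimir_eigen ij' t_inj tz.
    move/ffunP/(_ setT); rewrite ffunE -/w => ->.
    by rewrite sum_ffunE; apply: eq_bigr => n _; rewrite ffunE.
  rewrite !half //.
  (* The diagonal part acts on each summand by the form of its weights at sites i and j. *)
  have -> : \sum_a (-1) ^+ par a *: Esite i a a (Esite j a a (w setT)) =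
      \sum_(n in OP) (wf (lam i - \sum_(m <- n i) root m)
         (lam j - \sum_(m <- n j) root m) * omega z t n) *: xi_vector n setT.
    rewrite /w sum_ffunE; under eq_bigr do rewrite !linear_sum.
    rewrite exchange_big; apply: eq_bigr => n _ /=.
    rewrite /wform mulr_suml scaler_suml; apply: eq_bigr => a _.
    have wt k : Esite k a a (xi_vector n setT) = _ :=
      xi_vector_weight n k a setT.
    have wt2 : Esite i a a (Esite j a a (xi_vector n setT)) =
        ((lam i - \sum_(m <- n i) root m) 0 a *
         (lam j - \sum_(m <- n j) root m) 0 a) *: xi_vector n setT.
      by rewrite wt linearZ /= wt scalerA mulrC.
    rewrite [(_ *: xi_vector n) setT]ffunE !linearZ /=.
    transitivity (omega z t n *: ((-1) ^+ par a *:
        (((lam i - \sum_(m <- n i) root m) 0 a *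
          (lam j - \sum_(m <- n j) root m) 0 a) *: xi_vector n setT))).
      by congr (_ *: (_ *: _)); exact: wt2.
    by rewrite !scalerA; congr (_ *: _); ring.
  rewrite -!big_split scaler_sumr; apply: eq_bigr => n _ /=.
  by rewrite -!scalerDl -!mulrDl scalerA mulrA.
under eq_bigr => j ji do rewrite pairE //.
rewrite exchange_big sum_ffunE scaler_sumr; apply: eq_bigr => n nP /=.
by rewrite -scaler_suml -mulr_suml total_scalar // ffunE scalerA.
Qed.

End BetheVector.

Theorem theorem5p3 (R : realType) (m n r : nat) (par : 'I_r.+1 -> bool)
    (hmn : (m + n)%N = r.+1)
    (hm : #|[set a | ~~ par a]| = m) (hn : #|[set a | par a]| = n)
    (hpar : par ord0 = false)
    (N : nat) (hN : (1 < N)%N)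
    (z : 'I_N -> R[i]) (hz : injective z)
    (mu : 'I_N -> seq nat) (hmu : forall k, is_hook_partition m n (mu k))
    (lam : 'I_N -> 'rV[R[i]]_r.+1)
    (hlam : forall k, lam k = hook_weight R[i] par (mu k))
    (L : 'I_N -> glmod R[i] par)
    (hirr : forall k, irreducible (L k))
    (hpol : forall k, polynomial_module (L k))
    (v : forall k, 'cV[R[i]]_(mdim (L k))) (q : 'I_N -> bool)
    (hv : forall k, highest_weight_vector (lam k) (v k))
    (hq : forall k, homogeneous (q k) (v k))
    (l : nat) (ls : 'I_r -> nat) (hl : (\sum_p ls p)%N = l)
    (c : 'I_l -> 'I_r) (hc : forall p, #|[set i | c i == p]| = ls p)
    (t : 'I_l -> R[i]) (hbethe : bethe_equations par c z t lam) (i : 'I_N) :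
  gaudin z i (weight_function c z t v q) =
    gaudin_eigenvalue par c z t lam i *: weight_function c z t v q.
Proof. exact: weight_function_eigen. Qed.
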